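(* Let $F$ be a field and let $\Gamma=(V,E)$ be a finite uniform layered graph with $V=\coprod_{i=0}^N V_i$ having exactly one minimal vertex, this vertex being the unique element of $V_0$. Then the Hilbert series of the algebra $A(\Gamma)$ satisfies $$h(A(\Gamma),\tau)^{-1}=1-\sum_{a\in V,\ |a|\ge i,\ 0\le s\le i-1}(-1)^s\dim\big(H^{s-1}(\Gamma_{a,i})\big)\,\tau^i,$$ where the sum is over all triples $(a,i,s)$ with $a\in V$, $i$ an integer with $1\le i\le|a|$, and $s$ an integer with $0\le s\le i-1$.
   Context: Layered graphs: $\Gamma=(V,E)$ is a directed graph; for $e\in E$, $t(e)$ is its tail and $h(e)$ its head (the edge goes from $t(e)$ to $h(e)$). $\Gamma$ is layered if $V=\coprod_{i=0}^N V_i$ and, writing $|v|=i$ (the level of $v$) for $v\in V_i$, one has $|t(e)|=|h(e)|+1$ for every $e\in E$. $V$ is regarded as a poset: $u>v$ iff there is a directed path (with at least one edge) from $u$ to $v$. Thus having exactly one minimal vertex, lying in $V_0$, means $V_0=\{*\}$ and every vertex of positive level has an outgoing edge. Uniform: vertices $v,v'$ of the same level $i>0$ are connected by a down-up sequence if there are $v=v_0,v_1,\dots,v_k=v'$ in $V_i$ and $w_1,\dots,w_k\in V_{i-1}$ with $w_j<v_{j-1}$ and $w_j<v_j$ for $j=1,\dots,k$ (a vertex is connected to itself by the sequence with $k=0$). $\Gamma$ is uniform if for any two edges $e,e'$ with $t(e)=t(e')$, the heads $h(e),h(e')$ are connected by a down-up sequence $v_0,\dots,v_k$ with $v_j<t(e)$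 for all $j$. The algebra $A(\Gamma)$: the associative unital $F$-algebra generated by the edges $e\in E$, subject to the following relations: for any two directed paths $(e_1,\dots,e_k)$ and $(f_1,\dots,f_k)$ (with $h(e_j)=t(e_{j+1})$, $h(f_j)=t(f_{j+1})$) having the same tail $t(e_1)=t(f_1)$ and the same head $h(e_k)=h(f_k)$, all coefficients in the central variable $t$ of $(t-e_1)(t-e_2)\cdots(t-e_k)=(t-f_1)(t-f_2)\cdots(t-f_k)$ agree. It is graded with each edge in degree 1, and $h(A,\tau)=\sum_n\dim(A_n)\tau^n$. The graphs $\Gamma_{a,i}$: for $a\in V$ and $i\le|a|$, $\Gamma_{a,i}$ is the subgraph of $\Gamma$ induced by $\{w\in V: a>w,\ |a|-|w|\le i-1\}$, regarded as a poset. Cohomology: for a finite poset $P$, $H^j(P)$ denotes the reduced order cohomology with coefficients in $F$, i.e. the reduced simplicial cohomology of the order complex of $P$. Explicitly, for $j\ge -1$, $C_j(P)$ is the $F$-vector space with basis the $j$-chains $x_0<\dots<x_j$ in $P$ (the empty set is the unique $(-1)$-chain), $d_j:C_j\to C_{j-1}$ is $d_j(x_0,\dots,x_j)=\sum_l(-1)^l(x_0,\dots,\widehat{x_l},\dots,x_j)$, $C^j$ is the dual of $C_j$, $\partial^j:C^{j-1}\to C^j$ is dual to $d_j$, and $H^j(P)=\ker\partial^{j+1}/\operatorname{im}\partial^j$. In particular $H^{-1}(\emptyset)=F$. *)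

(* Defs.v *)
From HB Require Import structures.
From mathcomp Require Import all_boot all_order all_algebra.
From mathcomp Require Import boolp finmap.
From mathcomp.multinomials Require Import monalg.

Set Implicit Arguments.
Unset Strict Implicit.
Unset Printing Implicit Defensive.

Import Order.TTheory GRing.Theory.

Local Open Scope ring_scope.
Local Open Scope quotient_scope.

(** * Layered graphs *)

(* Finite layered graphs; parallel edges are allowed, and [V_i] is the set of
   vertices [v] with [level v = i]. *)
Record layered_graph := LayeredGraph {
  top_level : nat;
  vertex : finType;
  edge : finType;
  tail : edge -> vertex;
  head : edge -> vertex;
  level : vertex -> 'I_top_level.+1;
  level_tail : forall e, level (tail e) = (level (head e)).+1 :> nat
}.

Section Paths.
Context (G : layered_graph).
Implicit Types (u v : vertex G) (e : edge G) (p : seq (edge G)).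

(* [dipath u p v]: the sequence of edges [p] is nonempty and is a directed path
   with tail [u] and head [v]. *)
Definition dipath u p v : Prop :=
  if p is e :: p' then
    [/\ tail e = u, path (fun e1 e2 => head e1 == tail e2) e p'
      & head (last e p') = v]
  else False.

Lemma dipath_cat u p v q w :
  dipath u p v -> dipath v q w -> dipath u (p ++ q) w.
Proof.
case: p => [|e p] //= [te pp hp]; case: q => [|f q] //= [tf pq hq].
split=> //; last by rewrite last_cat.
by rewrite cat_path pp /= hp tf eqxx.
Qed.

Lemma dipath_level u p v : dipath u p v -> (level v < level u)%N.
Proof.
case: p => [|e p] //= [<- + <-].
elim: p e => [|f p IHp] e /=; first by rewrite level_tail.
case/andP=> /eqP hf /IHp lt_f; rewrite level_tail hf.
exact: leqW lt_f.
Qed.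

End Paths.

(* The vertex set of [G] seen as a poset: [v < u] iff there is a directed path
   with at least one edge from [u] to [v]. *)
Definition vposet (G : layered_graph) : Type := vertex G.

Section VertexPoset.
Context (G : layered_graph).

Definition vlt (v u : vposet G) : bool := `[< exists p, dipath u p v >].
Definition vle (v u : vposet G) : bool := (v == u :> vertex G) || vlt v u.

Lemma vlt_irr : irreflexive vlt.
Proof.
move=> v; apply/asboolP => -[p /dipath_level]; by rewrite ltnn.
Qed.

Lemma vlt_trans : transitive vlt.
Proof.
move=> v u w /asboolP[p up] /asboolP[q vq]; apply/asboolP.
by exists (q ++ p); apply: dipath_cat vq up.
Qed.

HB.instance Definition _ := Finite.on (vposet G).
HB.instance Definition _ :=
  Order.LtLe_isPOrder.Build (Order.Disp tt tt) (vposet G)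
    (fun _ _ => erefl) vlt_irr vlt_trans.

End VertexPoset.

(* [vs 0, ..., vs k] and [ws 0, ..., ws (k-1)] form a down-up sequence between
   [v] and [v'] (only these values of [vs] and [ws] matter, and the usual
   [w_j] is [ws (j-1)]).  When [v] has level 0 no [ws j] can exist, so that
   only [k = 0] is possible. *)
Definition down_up (G : layered_graph) (v v' : vposet G)
    (k : nat) (vs ws : nat -> vposet G) : Prop :=
  [/\ vs 0%N = v, vs k = v',
      forall j, (j <= k)%N -> level (vs j) = level v :> nat
    & forall j, (j < k)%N ->
        [/\ (level (ws j)).+1 = level v :> nat,
            (ws j < vs j)%O & (ws j < vs j.+1)%O]].

Definition uniform (G : layered_graph) : Prop :=
  forall e e' : edge G, tail e = tail e' ->
  exists (k : nat) (vs ws : nat -> vposet G),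
    down_up (head e : vposet G) (head e') k vs ws /\
    forall j, (j <= k)%N -> (vs j < (tail e : vposet G))%O.

Definition minimal_vertex (G : layered_graph) (v : vposet G) : Prop :=
  forall u : vposet G, ~ (u < v)%O.

Definition unique_minimal (G : layered_graph) : Prop :=
  exists m : vposet G,
    (forall v : vposet G, minimal_vertex v <-> v = m) /\
    (forall v : vposet G, level v = 0%N :> nat <-> v = m).

Section Induced.
Context (G : layered_graph) (W : {set vposet G}).

Definition ind_vertex := {v : vposet G | v \in W}.
Definition ind_edge := {e : edge G | (tail e \in W) && (head e \in W)}.

Definition ind_tail (e : ind_edge) : ind_vertex :=
  Sub (tail (val e)) (proj1 (andP (valP e))).
Definition ind_head (e : ind_edge) : ind_vertex :=
  Sub (head (val e)) (proj2 (andP (valP e))).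

Definition induced : layered_graph :=
  @LayeredGraph (top_level G) ind_vertex ind_edge ind_tail ind_head
    (fun v => level (val v)) (fun e => level_tail (val e)).

End Induced.

(* The graph Gamma_{a,i}; it is only used for [0 < i <= level a]. *)
Definition below (G : layered_graph) (a : vposet G) (i : nat) : layered_graph :=
  @induced G
    [set w : vposet G | (w < a)%O & (level a - level w <= i - 1)%N].

(** * Reduced order cohomology of a finite poset *)

Section OrderCohomology.
Context (F : fieldType) (d : Order.disp_t) (P : finPOrderType d).

(* Chains are indexed by their number of elements: [chain s] is the set of
   (s-1)-chains, and [chain 0] contains only the empty chain. *)
Definition chain (s : nat) := {c : s.-tuple P | sorted (fun x y => x < y)%O c}.

Lemma face_subproof s (c : chain s.+1) (l : 'I_s.+1) :
  sorted (fun x y => x < y)%O [tuple tnth (val c) (lift l j) | j < s].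
Proof.
have sc := valP c; set x0 := tnth (val c) l.
apply/(sortedP x0) => i; rewrite size_tuple => lt_i1s.
have lt_is := ltnW lt_i1s.
rewrite -[i]/(val (Ordinal lt_is)) -[(val _).+1]/(val (Ordinal lt_i1s)).
rewrite -!tnth_nth !tnth_mktuple !(tnth_nth x0).
apply: (sorted_ltn_nth lt_trans x0 sc); rewrite ?inE ?size_tuple ?ltn_ord //.
rewrite /= /bump -addnS leq_add2r.
by case: (leqP l i) => // /leqW ->.
Qed.

(* [face c l] is [c] with its element of index [l] omitted. *)
Definition face s (c : chain s.+1) (l : 'I_s.+1) : chain s :=
  Sub [tuple tnth (val c) (lift l j) | j < s] (face_subproof c l).

(* The space with basis the (s-1)-chains, i.e. C_{s-1}. *)
Definition chainsp (s : nat) := {ffun chain s -> F^o}.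

Definition chainb s (c : chain s) : chainsp s := [ffun c' => (c' == c)%:R].

Definition bdry_fun s (x : chainsp s.+1) : chainsp s :=
  \sum_c x c *: \sum_(l < s.+1) (-1) ^+ l *: chainb (face c l).

Lemma bdry_is_linear s : linear (@bdry_fun s).
Proof.
move=> a x y; rewrite /bdry_fun scaler_sumr -big_split /=.
by apply: eq_bigr => c _; rewrite !ffunE scalerDl scalerA.
Qed.
HB.instance Definition _ s :=
  GRing.isLinear.Build F (chainsp s.+1) (chainsp s) *:%R (@bdry_fun s)
    (@bdry_is_linear s).

(* d_s : C_s -> C_{s-1} *)
Definition bdry s : 'Hom(chainsp s.+1, chainsp s) := linfun (@bdry_fun s).

(* C^{s-1}, the dual of C_{s-1} *)
Definition cochainsp (s : nat) := 'Hom(chainsp s, F^o).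

Definition cobdry_fun s (f : cochainsp s) : cochainsp s.+1 :=
  (f \o bdry s)%VF.

Lemma cobdry_is_linear s : linear (@cobdry_fun s).
Proof. by move=> a f g; rewrite /cobdry_fun comp_lfunDl comp_lfunZl. Qed.
HB.instance Definition _ s :=
  GRing.isLinear.Build F (cochainsp s) (cochainsp s.+1) *:%R (@cobdry_fun s)
    (@cobdry_is_linear s).

(* The dual of d_s, from C^{s-1} to C^s *)
Definition cobdry s : 'Hom(cochainsp s, cochainsp s.+1) :=
  linfun (@cobdry_fun s).

Definition cocycles s : {vspace cochainsp s} := lker (cobdry s).

Definition coboundaries s : {vspace cochainsp s} :=
  match s with
  | 0 => 0%VS
  | s'.+1 => limg (cobdry s')
  end.

(* The dimension of H^{s-1}(P) = cocycles s / coboundaries s (note the shift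
   of degree). *)
Definition dim_cohom (s : nat) : nat :=
  (\dim (cocycles s) - \dim (coboundaries s))%N.

End OrderCohomology.

(** * The algebra A(Gamma) *)

Section Ideal.
Context (A : pzRingType).

Inductive ideal_gen (R : A -> Prop) : A -> Prop :=
| IdealGen x of R x : ideal_gen R x
| Ideal0 : ideal_gen R 0
| IdealD x y of ideal_gen R x & ideal_gen R y : ideal_gen R (x + y)
| IdealMl a x of ideal_gen R x : ideal_gen R (a * x)
| IdealMr a x of ideal_gen R x : ideal_gen R (x * a).

Lemma idealB R x y : ideal_gen R x -> ideal_gen R y -> ideal_gen R (x - y).
Proof. by move=> Ix Iy; rewrite -mulN1r; apply/IdealD/IdealMl. Qed.

End Ideal.

Section GraphAlgebra.
Context (F : fieldType) (G : layered_graph).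

(* The free associative unital algebra on the edges *)
Notation freeAlg := {malg F[{fmonom (edge G)}]}.

Lemma freeAlg_scalerAr (c : F) (x y : freeAlg) : c *: (x * y) = x * (c *: y).
Proof.
apply/malgP => k; rewrite mcoeffZ mcoeffMl.
rewrite (mcoeffMlw k (fsubset_refl (msupp x)) (msuppZ_le c y)).
rewrite mulr_sumr; apply: eq_bigr => i _.
rewrite mulr_sumr; apply: eq_bigr => j _.
by rewrite mcoeffZ mulrnAr mulrCA.
Qed.

Definition gen (e : edge G) : freeAlg := << fmu e >>.

(* (t - e_1) ... (t - e_k), in this order; in {poly R} the variable commutes
   with the coefficients. *)
Definition path_poly (p : seq (edge G)) : {poly freeAlg} :=
  \prod_(e <- p) ('X - (gen e)%:P).

Definition relator (x : freeAlg) : Prop :=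
  exists u v p q m,
    [/\ @dipath G u p v, @dipath G u q v, size p = size q
      & x = (path_poly p)`_m - (path_poly q)`_m].

Definition rel_ideal : {pred freeAlg} := fun x => `[< ideal_gen relator x >].

Lemma rel_idealP x : reflect (ideal_gen relator x) (x \in rel_ideal).
Proof. exact: asboolP. Qed.

Lemma rel_ideal_zmod_closed : zmod_closed rel_ideal.
Proof.
split=> [|x y /rel_idealP Ix /rel_idealP Iy]; apply/rel_idealP.
  exact: Ideal0.
exact: idealB.
Qed.
HB.instance Definition _ := GRing.isZmodClosed.Build freeAlg rel_ideal
  rel_ideal_zmod_closed.

Lemma rel_idealMl a x : x \in rel_ideal -> a * x \in rel_ideal.
Proof. by move=> /rel_idealP Ix; apply/rel_idealP/IdealMl. Qed.

Lemma rel_idealMr a x : x \in rel_ideal -> x * a \in rel_ideal.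
Proof. by move=> /rel_idealP Ix; apply/rel_idealP/IdealMr. Qed.

Lemma rel_idealZ c x : x \in rel_ideal -> c *: x \in rel_ideal.
Proof. by move=> Ix; rewrite -mul_malgC rel_idealMl. Qed.

Lemma rel_ideal1 : 1 \notin rel_ideal.
Proof.
apply/rel_idealP => I1.
suff eps0 (x : freeAlg) : ideal_gen relator x -> mcoeff (@mone {fmonom (edge G)}) x = 0.
  by have /eqP := eps0 _ I1; rewrite rmorph1 oner_eq0.
have epsP p : map_poly (mcoeff (@mone {fmonom (edge G)})) (path_poly p) = 'X^(size p).
  rewrite /path_poly; elim: p => [|e p IHp]; first by rewrite big_nil rmorph1.
  rewrite big_cons rmorphM /= IHp rmorphB /= map_polyX map_polyC /=.
  by rewrite mcoeffU1 fm1_eq1 subr0 -exprS.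
elim=> {x I1} [x [u [v [p [q [m [_ _ spq ->]]]]]]||x y _ ex _ ey|a x _ ex|a x _ ex].
- have epsE r : mcoeff mone (path_poly r)`_m = 'X^(size r)`_m :> F.
    by rewrite -epsP coef_map.
  by rewrite rmorphB /= !epsE spq subrr.
- exact: rmorph0.
- by rewrite rmorphD /= ex ey addr0.
- by rewrite rmorphM /= ex mulr0.
- by rewrite rmorphM /= ex mul0r.
Qed.

(* The algebra A(G), the quotient of the free algebra by the two-sided ideal
   generated by the relators *)
Definition graphAlg : Type := {ideal_quot rel_ideal}.

HB.instance Definition _ := GRing.Zmodule.on graphAlg.

Definition graphAlg_pi (x : freeAlg) : graphAlg := \pi_({ideal_quot rel_ideal}) x.
Local Notation "\p" := graphAlg_pi.

Definition graphAlg_one : graphAlg := \p 1.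
Definition graphAlg_mul (x y : graphAlg) : graphAlg :=
  \p (repr (x : {ideal_quot rel_ideal}) * repr (y : {ideal_quot rel_ideal})).
Definition graphAlg_scale (c : F) (x : graphAlg) : graphAlg :=
  \p (c *: repr (x : {ideal_quot rel_ideal})).

Lemma graphAlg_piP x y : \p x = \p y <-> x - y \in rel_ideal.
Proof. by rewrite Quotient.idealrBE; split=> [/eqP|/eqP]. Qed.

Lemma graphAlg_piK (x : graphAlg) : \p (repr (x : {ideal_quot rel_ideal})) = x.
Proof. exact: reprK. Qed.

Lemma graphAlg_reprK x :
  repr (\p x : {ideal_quot rel_ideal}) - x \in rel_ideal.
Proof. exact/graphAlg_piP/graphAlg_piK. Qed.

Lemma graphAlg_pi_surj (x : graphAlg) : exists y, x = \p y.
Proof. by exists (repr (x : {ideal_quot rel_ideal})); rewrite graphAlg_piK. Qed.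

Lemma graphAlg_piD x y : \p (x + y) = \p x + \p y.
Proof. exact: (Quotient.pi_add rel_ideal). Qed.

Lemma graphAlg_piM x y : \p (x * y) = graphAlg_mul (\p x) (\p y).
Proof.
apply/esym/graphAlg_piP; set x' := repr _; set y' := repr _.
have -> : x' * y' - x * y = (x' - x) * y' + x * (y' - y).
  by rewrite mulrBl mulrBr addrA addrNK.
apply: rpredD; first exact/rel_idealMr/graphAlg_reprK.
exact/rel_idealMl/graphAlg_reprK.
Qed.

Lemma graphAlg_piZ c x : \p (c *: x) = graphAlg_scale c (\p x).
Proof.
apply/esym/graphAlg_piP; rewrite -scalerBr.
exact/rel_idealZ/graphAlg_reprK.
Qed.

Let mulqA : associative graphAlg_mul.
Proof.
move=> x y z; case: (graphAlg_pi_surj x) (graphAlg_pi_surj y)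
  (graphAlg_pi_surj z) => {}x -> [{}y ->] [{}z ->].
by rewrite -!graphAlg_piM mulrA.
Qed.
Let mul1q : left_id graphAlg_one graphAlg_mul.
Proof.
by move=> x; case: (graphAlg_pi_surj x) => {}x ->; rewrite -graphAlg_piM mul1r.
Qed.
Let mulq1 : right_id graphAlg_one graphAlg_mul.
Proof.
by move=> x; case: (graphAlg_pi_surj x) => {}x ->; rewrite -graphAlg_piM mulr1.
Qed.
Let mulqDl : left_distributive graphAlg_mul +%R.
Proof.
move=> x y z; case: (graphAlg_pi_surj x) (graphAlg_pi_surj y)
  (graphAlg_pi_surj z) => {}x -> [{}y ->] [{}z ->].
by rewrite -!(graphAlg_piM, graphAlg_piD) mulrDl.
Qed.
Let mulqDr : right_distributive graphAlg_mul +%R.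
Proof.
move=> x y z; case: (graphAlg_pi_surj x) (graphAlg_pi_surj y)
  (graphAlg_pi_surj z) => {}x -> [{}y ->] [{}z ->].
by rewrite -!(graphAlg_piM, graphAlg_piD) mulrDr.
Qed.
Let oneq_neq0 : graphAlg_one != 0.
Proof.
have <- : \p 0 = 0.
  by apply: (addrI (\p 0)); rewrite -graphAlg_piD !addr0.
by apply/eqP => /graphAlg_piP; rewrite subr0; apply/negP/rel_ideal1.
Qed.
HB.instance Definition _ := GRing.Zmodule_isNzRing.Build graphAlg
  mulqA mul1q mulq1 mulqDl mulqDr oneq_neq0.

Let scaleqA a b x :
  graphAlg_scale a (graphAlg_scale b x) = graphAlg_scale (a * b) x.
Proof.
by case: (graphAlg_pi_surj x) => {}x ->; rewrite -!graphAlg_piZ scalerA.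
Qed.
Let scale1q : left_id 1 graphAlg_scale.
Proof.
by move=> x; case: (graphAlg_pi_surj x) => {}x ->; rewrite -graphAlg_piZ scale1r.
Qed.
Let scaleqDr : right_distributive graphAlg_scale +%R.
Proof.
move=> a x y; case: (graphAlg_pi_surj x) (graphAlg_pi_surj y) => {}x -> [{}y ->].
by rewrite -!(graphAlg_piZ, graphAlg_piD) scalerDr.
Qed.
Let scaleqDl x : {morph graphAlg_scale^~ x : a b / a + b}.
Proof.
move=> a b; case: (graphAlg_pi_surj x) => {}x ->.
by rewrite -!(graphAlg_piZ, graphAlg_piD) scalerDl.
Qed.
HB.instance Definition _ := GRing.Zmodule_isLmodule.Build F graphAlg
  scaleqA scale1q scaleqDr scaleqDl.

Let scaleqAl (a : F) (x y : graphAlg) : a *: (x * y) = (a *: x) * y.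
Proof.
case: (graphAlg_pi_surj x) (graphAlg_pi_surj y) => {}x -> [{}y ->].
change (graphAlg_scale a (graphAlg_mul (\p x) (\p y)) =
        graphAlg_mul (graphAlg_scale a (\p x)) (\p y)).
by rewrite -(graphAlg_piZ a x) -(graphAlg_piM x y) -(graphAlg_piM (a *: x) y)
  -(graphAlg_piZ a (x * y)) scalerAl.
Qed.
HB.instance Definition _ := GRing.Lmodule_isLalgebra.Build F graphAlg scaleqAl.

Let scaleqAr (a : F) (x y : graphAlg) : a *: (x * y) = x * (a *: y).
Proof.
case: (graphAlg_pi_surj x) (graphAlg_pi_surj y) => {}x -> [{}y ->].
change (graphAlg_scale a (graphAlg_mul (\p x) (\p y)) =
        graphAlg_mul (\p x) (graphAlg_scale a (\p y))).
by rewrite -(graphAlg_piZ a y) -(graphAlg_piM x y) -(graphAlg_piM x (a *: y))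
  -(graphAlg_piZ a (x * y)) freeAlg_scalerAr.
Qed.
HB.instance Definition _ := GRing.Lalgebra_isAlgebra.Build F graphAlg scaleqAr.

(* The component A_n of the grading with all edges in degree 1: the image of
   the linear combinations of words of length n *)
Definition graphAlg_comp (n : nat) (y : graphAlg) : Prop :=
  exists2 x : freeAlg, (forall k, k \in msupp x -> fdeg k = n) & y = \p x.

End GraphAlgebra.

(** * Dimensions and the Hilbert series *)

Section Dimension.
Context (F : fieldType) (V : lmodType F) (S : V -> Prop).

(* The subspace S has a basis with n elements. *)
Definition has_dim (n : nat) : Prop :=
  exists b : 'I_n -> V,
    [/\ forall i, S (b i),
        forall c : 'I_n -> F, \sum_i c i *: b i = 0 -> forall i, c i = 0
      & forall v, S v -> exists c : 'I_n -> F, v = \sum_i c i *: b i].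

(* The dimension of S if it is finite-dimensional, and 0 otherwise *)
Definition subdim : nat :=
  if pselect (exists n, has_dim n) is left ex then projT1 (cid ex) else 0%N.

End Dimension.

Definition hilbert_coef (F : fieldType) (G : layered_graph) (n : nat) : nat :=
  subdim (@graphAlg_comp F G n).

(* A power series over [int] is given by its sequence of coefficients. *)
Definition series_mul (f g : nat -> int) : nat -> int :=
  fun n => \sum_(k < n.+1) f k * g (n - k)%N.

Definition series_inverse (f g : nat -> int) : Prop :=
  forall n, series_mul f g n = (n == 0%N)%:R.

(* Main.v *)
From HB Require Import structures.
From mathcomp Require Import all_boot all_order all_algebra.
From mathcomp Require Import boolp finmap.
From mathcomp.multinomials Require Import monalg.
Require Import Defs.
From mathcomp Require Import zify.

(** Let [P_v(t) = (t - e_1) ... (t - e_n)] be the product along a path from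
    [v] down to the bottom vertex.  By the relations of the algebra [A] it does
    not depend on the path; let [c_k(v)] be its coefficient at [t^(|v| - k)].
    An edge from [v] to [w] equals [c_1(w) - c_1(v)], so the letters [(v, k)],
    [1 <= k <= |v|], standing for [c_k(v)], generate [A].  If [u < v] then
    [P_u] divides [P_v] on the right, and comparing coefficients yields, with
    [K = |v| - |u|],

      [c_K(v) c_l(u) = c_(K+l)(v) + products of smaller weight],

    where [(v, k)] has weight [|v| + (|v| - 1) + ... + (|v| - k + 1)].  Call a
    word normal if it has no consecutive letters [(v, |v| - |u|) (u, l)] with
    [u < v].  Then normal words span [A] ([graphAlg_normal_span]), and the
    dimension [h_n] of [A_n] is at most the number [B_n] of normal words of
    degree [n].

    The converse inequality goes by induction on [n].  The augmentation
    ideal of [A] is a right module with generators [Q_(v,k)], corresponding to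
    [c_k(v)], and with the following relations.  For [w < v] the polynomial
    [Q_v - t^(|v| - |w|) Q_w], where [Q_v] is the sum of the
    [Q_(v,k) t^(|v| - k)], is divisible by [P_w] on the right, that is, its
    remainder [R_(v,w)] is zero.  That there are no other relations is shown
    by a map from the free algebra to the free right module
    ([graded_vec_ideal], [slot_vec_lift]).  For [u < w], the remainder
    [R_(v,w)] is divisible by [P_u] modulo the relations [R_(v,u)] and
    [R_(w,u)] ([rel_poly_division]); so its coefficients can be treated like
    the letters [(w, k)], and the right module that they generate is spanned,
    modulo relations of smaller level, by as many elements as there are normal
    words starting with [w] ([rel_space_words]).  Writing [b_w(n)] for the
    number of these words in degree [n], this gives, for [n > 0],

      [h_n >= sum_v sum_k h_(n-k) - sum_(w < v) b_w(n - |v| + |w|)].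

    By induction the right hand side is [B_n], because a letter [(v, k)]
    followed by a normal word is not normal exactly when that word starts with
    a vertex [w < v] of level [|v| - k] ([nb_words_from_rec]).  Hence
    [h_n = B_n] ([hilbert_coef_nb_words]).

    The same recursion, unrolled along the chains [v > w > ...], expresses
    [b_v(n)] as a combination of the [B_(n-i)] whose coefficients are the
    alternating sums over the chains of Gamma_{v,i} ([nb_words_from_chi]).  By
    the Euler-Poincare formula these are the alternating sums of dimensions of
    cohomology spaces, and summing over [v] gives the inverse of the Hilbert
    series. *)

Set Implicit Arguments.
Unset Strict Implicit.
Unset Printing Implicit Defensive.

Import Order.TTheory GRing.Theory Pdiv.Ring Pdiv.RingMonic.
Local Open Scope ring_scope.

(** * Linear spans and dimensions *)

Section LinearSpan.
Context (F : fieldType).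

Inductive lspan (V : lmodType F) (P : V -> Prop) : V -> Prop :=
| lspan_mem x of P x : lspan P x
| lspan0 : lspan P 0
| lspanD x y of lspan P x & lspan P y : lspan P (x + y)
| lspanZ c x of lspan P x : lspan P (c *: x).

Context (V : lmodType F).
Implicit Types (P Q : V -> Prop) (x y : V).

Lemma lspanN P x : lspan P x -> lspan P (- x).
Proof. by rewrite -scaleN1r; apply: lspanZ. Qed.

Lemma lspanB P x y : lspan P x -> lspan P y -> lspan P (x - y).
Proof. by move=> Px Py; apply/lspanD/lspanN. Qed.

Lemma lspan_subl P x y : lspan P (x - y) -> lspan P y -> lspan P x.
Proof. by move=> Pxy Py; rewrite -(subrK y x); apply: lspanD. Qed.

Lemma lspan_subr P x y : lspan P (x - y) -> lspan P x -> lspan P y.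
Proof. by move=> Pxy Px; rewrite -(subKr x y); apply: lspanB. Qed.

Lemma lspan_sum P (I : Type) (r : seq I) (C : pred I) (f : I -> V) :
  (forall i, C i -> lspan P (f i)) -> lspan P (\sum_(i <- r | C i) f i).
Proof. by move=> Pf; apply: big_ind => //; [apply: lspan0|apply: lspanD]. Qed.

Lemma lspan_linear (W : lmodType F) P (Q : W -> Prop) (f : {linear V -> W}) x :
  (forall y, P y -> lspan Q (f y)) -> lspan P x -> lspan Q (f x).
Proof.
move=> PQ; elim=> {x} [x /PQ//||x y _ Qx _ Qy|c x _ Qx].
- by rewrite linear0; apply: lspan0.
- by rewrite linearD; apply: lspanD.
- by rewrite linearZ; apply: lspanZ.
Qed.

Lemma lspan_map (W : lmodType F) P (Q : W -> Prop) (f : V -> W) x :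
  linear f -> (forall y, P y -> lspan Q (f y)) -> lspan P x -> lspan Q (f x).
Proof.
move=> lin_f; pose fl : {linear V -> W} :=
  HB.pack f (GRing.isLinear.Build F V W *:%R f lin_f).
exact: (@lspan_linear _ P Q fl).
Qed.

Lemma lspan_trans P Q x :
  (forall y, P y -> lspan Q y) -> lspan P x -> lspan Q x.
Proof. exact: (@lspan_linear _ P Q idfun). Qed.

Lemma lspan_mono P Q x : (forall y, P y -> Q y) -> lspan P x -> lspan Q x.
Proof. by move=> PQ; apply: lspan_trans => y /PQ; apply: lspan_mem. Qed.

Lemma lspan_famP (J : finType) (g : J -> V) x :
  lspan (fun y => exists j, y = g j) x <->
  exists c : J -> F, x = \sum_j c j *: g j.
Proof.
split=> [|[c ->]]; last first.
  by apply: lspan_sum => j _; apply/lspanZ/lspan_mem; exists j.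
elim=> {x} [x [j ->]||x y _ [c ->] _ [d ->]|a x _ [c ->]].
- exists (fun i => (i == j)%:R); rewrite (bigD1 j) //= eqxx scale1r big1 ?addr0//.
  by move=> i /negPf->; rewrite scale0r.
- by exists (fun=> 0); rewrite big1 // => j _; rewrite scale0r.
- exists (fun j => c j + d j); rewrite -big_split.
  by apply: eq_bigr => j _; rewrite scalerDl.
- exists (fun j => a * c j); rewrite scaler_sumr.
  by apply: eq_bigr => j _; rewrite scalerA.
Qed.

Definition independent (J : finType) (b : J -> V) :=
  forall c : J -> F, \sum_j c j *: b j = 0 -> forall j, c j = 0.

(** Steinitz: more vectors than generators always satisfy a relation, the
    coefficient matrix having a nonzero left kernel. *)
Lemma independent_leq (J L : finType) (b : J -> V) (g : L -> V) :
  independent b -> (forall j, lspan (fun y => exists l, y = g l) (b j)) ->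
  (#|J| <= #|L|)%N.
Proof.
move=> ind_b /(_ _)/lspan_famP-/choice[C bE].
pose M := \matrix_(i < #|J|, k < #|L|) C (enum_val i) (enum_val k).
suff : row_free M by rewrite /row_free => /eqP <-; apply: rank_leq_col.
apply/inj_row_free => u uM0; apply/rowP => i; rewrite mxE.
rewrite -[i]enum_valK.
apply: (ind_b (fun j => u 0 (enum_rank j))).
under eq_bigr => j _ do rewrite bE scaler_sumr.
rewrite exchange_big big1 //= => l _.
under eq_bigr => j _ do rewrite scalerA.
rewrite -scaler_suml (_ : \sum_j _ = (u *m M) 0 (enum_rank l)).
  by rewrite uM0 mxE scale0r.
rewrite mxE (reindex (@enum_val J predT)) /=; last first.
  by apply: onW_bij; exists enum_rank; [apply: enum_valK|apply: enum_rankK].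
by apply: eq_bigr => k _; rewrite mxE enum_valK enum_rankK.
Qed.

Lemma lspan_seq (s : seq V) x :
  lspan (fun y => y \in s) x ->
  lspan (fun y => exists i : 'I_(size s), y = s`_i) x.
Proof.
apply: lspan_mono => y ys.
have iP : (index y s < size s)%N by rewrite index_mem.
by exists (Ordinal iP); rewrite /= nth_index.
Qed.

Lemma independent_leq_size (J : finType) (b : J -> V) (s : seq V) :
  independent b -> (forall j, lspan (fun y => y \in s) (b j)) ->
  (#|J| <= size s)%N.
Proof.
move=> ind_b bs; rewrite -[size s]card_ord.
by apply: independent_leq ind_b _ => j; apply: lspan_seq.
Qed.

(** A spanning family with the least possible number of elements is
    independent, a relation allowing one of them to be dropped. *)
Lemma has_dim_exists (S : V -> Prop) (s : seq V) :
  (forall x, x \in s -> S x) -> (forall x, S x -> lspan (fun y => y \in s) x) ->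
  exists2 n, has_dim S n & (n <= size s)%N.
Proof.
move=> sS Ss.
pose spans n := `[< exists b : 'I_n -> V, (forall i, S (b i)) /\
   forall x, S x -> lspan (fun y => exists i, y = b i) x >].
have ex_n : exists n, spans n.
  exists (size s); apply/asboolP; exists (fun i => s`_i).
  by split=> [i|x /Ss/lspan_seq//]; apply/sS/mem_nth.
case: (ex_minnP ex_n) => n /asboolP[b [Sb spb]] minn.
have ind_b : independent b.
  move=> c sum0 j; apply/eqP/negPn/negP => cj.
  case: n => [|n] in b Sb spb c sum0 j minn cj *; first by case: j {cj}.
  suff /minn : spans n by rewrite ltnn.
  apply/asboolP; exists (b \o lift j); split=> [i|x /spb]; first exact: Sb.
  apply: lspan_trans => _ [i ->]; case: (unliftP j i) => [k|] ->.
    by apply: lspan_mem; exists k.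
  have -> : b j = \sum_(k < n) (- (c j)^-1 * c (lift j k)) *: b (lift j k).
    move: sum0; rewrite (bigD1_ord j) //= => /eqP; rewrite addr_eq0 => /eqP cbj.
    apply: (scalerI cj); rewrite cbj scaler_sumr -sumrN; apply: eq_bigr => k _.
    by rewrite scalerA mulrA mulrN mulfV // mulN1r scaleNr.
  by apply/lspan_famP; exists (fun k => - (c j)^-1 * c (lift j k)).
exists n; first by exists b; split=> // v /spb/lspan_famP.
rewrite -[n]card_ord; apply: independent_leq_size ind_b _ => j; exact/Ss/Sb.
Qed.

Lemma subdimE (S : V -> Prop) n : has_dim S n -> subdim S = n.
Proof.
move=> dim_n; rewrite /subdim; case: pselect => [ex|]; last by case; exists n.
case: cid => m /= dim_m.
have leq_dim k l : has_dim S k -> has_dim S l -> (k <= l)%N.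
  move=> [b [Sb ind_b _]] [g [_ _ spg]].
  rewrite -[k]card_ord -[l]card_ord; apply: independent_leq ind_b _ => j.
  by apply/lspan_famP/spg.
by apply/eqP; rewrite eqn_leq !leq_dim.
Qed.

End LinearSpan.

Lemma lspan_mul (F : fieldType) (R : lalgType F) (P Q S : R -> Prop) a b :
  (forall c (x y : R), c *: (x * y) = x * (c *: y)) ->
  (forall x y, P x -> Q y -> lspan S (x * y)) ->
  lspan P a -> lspan Q b -> lspan S (a * b).
Proof.
move=> scaleAr PQS Pa Qb; elim: Pa => {a} [x Px||x y _ Sx _ Sy|c x _ Sx].
- elim: Qb => {b} [y Qy||y z _ Sy _ Sz|c y _ Sy]; first exact: PQS.
  + by rewrite mulr0; apply: lspan0.
  + by rewrite mulrDr; apply: lspanD.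
  + by rewrite -scaleAr; apply: lspanZ.
- by rewrite mul0r; apply: lspan0.
- by rewrite mulrDl; apply: lspanD.
- by rewrite -scalerAl; apply: lspanZ.
Qed.

Lemma lspan_eq (F : fieldType) (V W : lmodType F) (P : V -> Prop) (f g : V -> W) x :
  linear f -> linear g -> (forall y, P y -> f y = g y) -> lspan P x -> f x = g x.
Proof.
move=> lin_f lin_g fg Px; apply/eqP; rewrite -subr_eq0; apply/eqP.
have lin_fg : linear (fun y => f y - g y).
  by move=> a u v; rewrite lin_f lin_g scalerBr opprD addrACA.
have : lspan (fun _ : W => False) (f x - g x).
  apply: (lspan_map lin_fg) Px => y /fg->; rewrite subrr; exact: lspan0.
elim=> // [u v _ -> _ ->|a u _ ->]; first by rewrite addr0.
by rewrite scaler0.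
Qed.

(** * Normal words *)

Section Words.
Context (G : layered_graph).
Implicit Types (u v w : vposet G).
Local Open Scope nat_scope.

Lemma lt_level u v : (u < v)%O -> level u < level v.
Proof. by case/asboolP => p /dipath_level. Qed.

Definition letter : Type := vposet G * nat.
Implicit Types (a b : letter) (z : seq letter).

(** The sum of the levels of the [k] vertices where the edges of a path of [k]
    edges from [v] start.  It is what orders the rewriting of words: merging
    [(v, |v| - |u|)] and [(u, l)] into the letter [(v, |v| - |u| + l)]
    preserves it. *)
Definition weight v k := \sum_(j < k) (level v - j).

Lemma weight_cat u v j l :
  j + level u = level v -> weight v j + weight u l = weight v (j + l).
Proof.
move=> juv; rewrite /weight big_split_ord /=; congr (_ + _).
by apply: eq_bigr => i _; rewrite -juv subnDl.
Qed.

Lemma weight_cat_lt u v j l : j + level u < level v -> 0 < l ->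
  weight v j + weight u l < weight v (j + l).
Proof.
case: l => // l juv _; rewrite /weight big_split_ord /= ltn_add2l.
rewrite !big_ord_recl /= !subn0 !addn0 -addSn leq_add //.
  by rewrite ltn_subRL.
by apply: leq_sum => i _; rewrite subnDA leq_sub2r // leq_subRL; lia.
Qed.

Definition letter_ok a := 0 < a.2 <= level a.1.
Definition wdeg z := \sum_(a <- z) a.2.
Definition wweight z := \sum_(a <- z) weight a.1 a.2.

(** Pairs of letters that can be merged, up to words of smaller weight. *)
Definition clash a b := (b.1 < a.1)%O && (a.2 == level a.1 - level b.1).
Definition normal z := sorted (fun a b => ~~ clash a b) z.

Definition head_ok a z := if z is b :: _ then ~~ clash a b else true.

Lemma normal_cons a z : normal (a :: z) = head_ok a z && normal z.
Proof. by case: z. Qed.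

Definition extensions (f : nat -> seq (seq letter)) v n :=
  flatten [seq [seq (v, k) :: z | z <- f (n - k) & head_ok (v, k) z]
          | k <- iota 1 (minn n (level v))].

(** The degree drops at each letter, so that a recursion depth [d] at least
    equal to the degree [n] is enough. *)
Fixpoint normal_words_rec d n : seq (seq letter) :=
  if d is d'.+1 then
    if n is 0 then [:: [::]]
    else flatten [seq extensions (normal_words_rec d') v n | v <- enum {: vposet G}]
  else [:: [::]].

Definition normal_words n := normal_words_rec n n.
Definition normal_words_from v n := extensions normal_words v n.

Lemma eq_extensions f g v n :
  (forall m, m < n -> f m = g m) -> extensions f v n = extensions g v n.
Proof.
move=> eq_fg; congr flatten; apply/eq_in_map => k; rewrite mem_iota => lt_k.
by rewrite eq_fg //; lia.
Qed.

Lemma normal_words_recE d n : n <= d -> normal_words_rec d n = normal_words n.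
Proof.
rewrite /normal_words.
have [m] := ubnP n; elim: m n d => // m IHm [|n] d; first by case: d.
rewrite ltnS => lt_nm; case: d => // d le_nd /=; congr flatten.
apply: eq_map => v; apply: eq_extensions => k lt_k.
have [km kd kn] : [/\ k < m, k <= d & k <= n] by split; lia.
by rewrite (IHm k d) ?(IHm k n).
Qed.

Lemma normal_wordsE n : 0 < n ->
  normal_words n =
    flatten [seq normal_words_from v n | v <- enum {: vposet G}].
Proof.
case: n => // n _; congr flatten; apply: eq_map => v.
by apply: eq_extensions => k lt_k; apply: (@normal_words_recE n).
Qed.

Lemma mem_normal_words_from v k z n :
  letter_ok (v, k) -> head_ok (v, k) z -> z \in normal_words n ->
  ((v, k) :: z) \in normal_words_from v (k + n).
Proof.
case/andP=> /= k0 kv ok_z nz; apply/flattenP.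
exists [seq (v, k) :: z | z <- normal_words n & head_ok (v, k) z].
  apply/mapP; exists k; first by rewrite mem_iota; lia.
  by rewrite addKn.
by apply: map_f; rewrite mem_filter ok_z.
Qed.

Lemma mem_normal_words z :
  all letter_ok z -> normal z -> z \in normal_words (wdeg z).
Proof.
elim: z => [|[v k] z IHz]; first by rewrite /wdeg big_nil inE.
rewrite normal_cons => /andP[ok_vk ok_z] /andP[hz nz].
have [/= k0 kv] := andP ok_vk; rewrite /wdeg big_cons /= -/(wdeg z).
rewrite normal_wordsE; last by rewrite ltn_addr.
apply/flattenP; exists (normal_words_from v (k + wdeg z)).
  by apply: map_f; rewrite mem_enum.
by apply: mem_normal_words_from => //; apply: IHz.
Qed.

Lemma normal_words_fromP v n z : z \in normal_words_from v n ->
  exists k z', [/\ z = (v, k) :: z', letter_ok (v, k), k <= n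
                 & z' \in normal_words (n - k)].
Proof.
case/flattenP=> s /mapP[k]; rewrite mem_iota => lt_k -> /mapP[z'].
rewrite mem_filter => /andP[_ z'P] ->.
by exists k, z'; split=> //; [rewrite /letter_ok /=; lia|lia].
Qed.

Lemma normal_wordsP n z : z \in normal_words n -> all letter_ok z /\ wdeg z = n.
Proof.
have [m] := ubnP n; elim: m n z => // m IHm n z.
rewrite ltnS => le_nm; have [->|n0] := posnP n.
  by rewrite inE => /eqP->; rewrite /wdeg big_nil.
rewrite normal_wordsE // => /flattenP[s /mapP[v _ ->]].
case/normal_words_fromP=> k [z' [-> ok_vk le_kn]].
have [/= k0 kv] := andP ok_vk.
case/IHm => [|ok_z' deg_z']; first by lia.
by rewrite /wdeg big_cons -/(wdeg _) deg_z' /= ok_vk ok_z'; split=> //; lia.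
Qed.

Definition nb_words n := size (normal_words n).
Definition nb_words_from v n := size (normal_words_from v n).

Lemma nb_words0 : nb_words 0 = 1. Proof. by []. Qed.

Lemma nb_words_from0 v : nb_words_from v 0 = 0.
Proof. by rewrite /nb_words_from /normal_words_from /extensions min0n. Qed.

Lemma nb_wordsE n : 0 < n -> nb_words n = \sum_v nb_words_from v n.
Proof.
move=> n0; rewrite /nb_words normal_wordsE // size_flatten /shape -map_comp.
by rewrite sumnE big_map big_enum.
Qed.

(** The normal words that cannot follow [(v, k)] are those starting with a
    vertex below [v] of level [|v| - k]. *)
Lemma count_head_ok v k n : k <= level v ->
  count (head_ok (v, k)) (normal_words n) +
    \sum_(u | (u < v)%O && (k == level v - level u)) nb_words_from u n
  = nb_words n.
Proof.
move=> kv; have [->|n0] := posnP n.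
  by rewrite big1 // => u _; rewrite nb_words_from0.
rewrite nb_wordsE // [in RHS](bigID (fun u => clash (v, k) (u, 0))) /= addnC.
congr (_ + _); rewrite normal_wordsE // count_flatten -map_comp sumnE big_map.
rewrite big_enum [RHS]big_mkcond; apply: eq_bigr => u _ /=.
have [cl|ncl] := boolP (clash (v, k) (u, 0)).
  apply/eqP; rewrite eqn0Ngt -has_count; apply/hasP => -[z].
  by case/normal_words_fromP => l [z' [-> _ _ _]]; rewrite /head_ok [clash _ _]cl.
apply/eqP; rewrite -all_count; apply/allP => z.
by case/normal_words_fromP => l [z' [-> _ _ _]] /=; exact: ncl.
Qed.

(** Each normal word starting with [v] is a letter [(v, k)] followed by an
    allowed normal word; the forbidden ones are counted by the second sum on
    the left.  When [n < |v| - |u|] the truncated difference is [0], and no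
    word of degree [0] starts with a letter. *)
Lemma nb_words_from_rec v n :
  nb_words_from v n +
    \sum_(u | (u < v)%O) nb_words_from u (n - (level v - level u))
  = \sum_(1 <= k < (minn n (level v)).+1) nb_words (n - k).
Proof.
have -> : nb_words_from v n = \sum_(1 <= k < (minn n (level v)).+1)
    count (head_ok (v, k)) (normal_words (n - k)).
  rewrite /nb_words_from size_flatten /shape -map_comp sumnE big_map.
  rewrite /index_iota subn1.
  by apply: eq_bigr => k _ /=; rewrite size_map size_filter.
pose P k u := (u < v)%O && (k == level v - level u).
have -> : \sum_(u | (u < v)%O) nb_words_from u (n - (level v - level u)) =
    \sum_(1 <= k < (minn n (level v)).+1) \sum_(u | P k u) nb_words_from u (n - k).
  under [RHS]eq_bigr => k _ do rewrite big_mkcond.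
  rewrite exchange_big big_mkcond; apply: eq_bigr => u _.
  rewrite /P; case: ifP => [uv|_] /=; last by rewrite big1.
  have lt_uv := lt_level uv.
  have [le_n|lt_n] := leqP (level v - level u) n.
    rewrite (bigD1_seq (level v - level u)) ?iota_uniq //=; last first.
      by rewrite mem_index_iota; lia.
    by rewrite eqxx big1 ?addn0 // => k /negPf->.
  rewrite (_ : n - _ = 0); last by lia.
  rewrite nb_words_from0 big_seq big1 // => k; rewrite mem_index_iota => lt_k.
  by case: eqP => //; lia.
rewrite -big_split; apply: eq_big_nat => k lt_k /=.
by apply: count_head_ok; lia.
Qed.

End Words.

Section WordLemmas.
Context (G : layered_graph).
Implicit Types (z : seq (letter G)).

Lemma wdeg_cons a z : wdeg (a :: z) = (a.2 + wdeg z)%N.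
Proof. by rewrite /wdeg big_cons. Qed.

Lemma wdeg_cat z z' : wdeg (z ++ z') = (wdeg z + wdeg z')%N.
Proof. by rewrite /wdeg big_cat. Qed.

Lemma wweight_cons a z : wweight (a :: z) = (weight a.1 a.2 + wweight z)%N.
Proof. by rewrite /wweight big_cons. Qed.

Lemma wweight_cat z z' : wweight (z ++ z') = (wweight z + wweight z')%N.
Proof. by rewrite /wweight big_cat. Qed.

Lemma not_normalP z : ~~ normal z ->
  exists z1 a b z2, z = z1 ++ a :: b :: z2 /\ clash a b.
Proof.
elim: z => // a z IHz; rewrite normal_cons negb_and => /orP[|/IHz].
  by case: z {IHz} => // b z /negPn cl; exists [::], a, b, z.
by case=> [z1 [b [b' [z2 [-> cl]]]]]; exists (a :: z1), b, b', z2.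
Qed.

End WordLemmas.

(** * Directed paths *)

Section Dipaths.
Context (G : layered_graph).
Implicit Types (u v : vposet G) (p : seq (edge G)).

Definition dipath_or_nil u p v : Prop := if p is [::] then u = v else dipath u p v.

Lemma dipath_dipath_or_nil u p v : dipath u p v -> dipath_or_nil u p v.
Proof. by case: p. Qed.

Lemma dipath_cons u e p v : dipath u (e :: p) v -> u = tail e /\ dipath_or_nil (head e) p v.
Proof.
case: p => [|f p] /= [<-]; first by [].
by case/andP=> /eqP hf pp lv.
Qed.

End Dipaths.

Section Descent.
Context (G : layered_graph) (hmin : unique_minimal G).
Implicit Types (u v w : vposet G).

Lemma dipath_size u p v : dipath u p v -> (size p + level v = level u)%N.
Proof.
case: p => [|e p] //= [<- + <-].
elim: p e => [|f p IHp] e /=; first by rewrite level_tail.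
by case/andP=> /eqP hf /IHp eq_f; rewrite level_tail hf -eq_f.
Qed.

Lemma bottom_unique u v : level u = 0%N :> nat -> level v = 0%N :> nat -> u = v.
Proof. by case: hmin => m [_ Hm] /Hm-> /Hm->. Qed.

(** Vertices of positive level are not minimal, so that one can always go
    further down. *)
Lemma descent_exists v : exists p : seq (edge G),
  if level v == 0%N :> nat then p = [::]
  else exists2 u : vposet G, level u = 0%N :> nat & dipath v p u.
Proof.
have [n] := ubnP (level v); elim: n v => // n IHn v; rewrite ltnS => le_vn.
have [v0|v0] := eqVneq (nat_of_ord (level v)) 0%N; first by exists [::].
have [u uv] : exists u, (u < v)%O.
  apply/not_existsP => noU; case: hmin => m [Hmin Hlev]; case/eqP: v0.
  by apply/Hlev/Hmin.
have [p vpu] := asboolP _ uv; have := lt_level uv => lt_uv.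
have [|q] := IHn u; first by lia.
case: eqP => [u0 _|_ [w w0 uqw]]; first by exists p, u.
by exists (p ++ q), w => //; apply: dipath_cat uqw.
Qed.

Definition descent v : seq (edge G) := projT1 (cid (descent_exists v)).

Lemma descent_bottom v : level v = 0%N :> nat -> descent v = [::].
Proof. by rewrite /descent; case: cid => p /= + v0; rewrite v0. Qed.

Lemma dipath_descent v : level v != 0%N :> nat ->
  exists2 u : vposet G, level u = 0%N :> nat & dipath v (descent v) u.
Proof. by rewrite /descent; case: cid => p /= + /negPf v0; rewrite v0. Qed.

Lemma size_descent v : size (descent v) = level v.
Proof.
have [v0|/dipath_descent[u u0 /dipath_size]] := eqVneq (nat_of_ord (level v)) 0%N.
  by rewrite descent_bottom // v0.
by rewrite u0 addn0.
Qed.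

End Descent.

(** * The free algebra *)

Section Monomials.
Context (F : fieldType) (E : choiceType).
Local Notation freeAlg := {malg F[{fmonom E}]}.

Definition word_monom (s : seq E) : freeAlg := << FMonom s >>.

Lemma word_monom_cat s s' :
  word_monom (s ++ s') = word_monom s * word_monom s'.
Proof.
rewrite /word_monom malgM_def fgmulUU mulr1; congr << _ >>.
by apply/val_inj; rewrite /= fmM.
Qed.

Lemma word_monom0 : word_monom [::] = 1.
Proof. by rewrite /word_monom; congr << _ >>; apply/val_inj; rewrite /= fm1. Qed.

Lemma malg_span (x : freeAlg) :
  lspan (fun y => exists2 s, FMonom s \in msupp x & y = word_monom s) x.
Proof.
rewrite {2}[x]monalgE big_seq; apply: lspan_sum => -[s] sx.
have -> : << x@_(FMonom s) *g FMonom s >> = x@_(FMonom s) *: word_monom s.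
  by apply/malgP => k; rewrite mcoeffZ !mcoeffU mulr_natr.
by apply/lspanZ/lspan_mem; exists s.
Qed.

Context (W : lmodType F) (f : seq E -> W).

Definition linear_ext (x : freeAlg) : W := \sum_(k <- msupp x) x@_k *: f k.

Lemma linear_ext_is_linear : linear linear_ext.
Proof.
move=> a x y; rewrite /linear_ext.
pose d := (msupp (a *: x + y) `|` (msupp x `|` msupp y))%fset.
have sumE (z : freeAlg) : (msupp z `<=` d)%fset ->
    \sum_(k <- msupp z) z@_k *: f k = \sum_(k <- d) z@_k *: f k.
  move=> zd; rewrite (big_fset_incl _ zd) //= => k _ /mcoeff_outdom->.
  by rewrite scale0r.
rewrite !sumE /d; try by apply/fsubsetP => k; rewrite !in_fsetU => ->; rewrite ?orbT.
rewrite scaler_sumr -big_split; apply: eq_bigr => k _ /=.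
by rewrite mcoeffD mcoeffZ scalerDl scalerA.
Qed.
HB.instance Definition _ :=
  GRing.isLinear.Build F freeAlg W *:%R linear_ext linear_ext_is_linear.

Lemma linear_ext_monom s : linear_ext (word_monom s) = f s.
Proof.
rewrite /linear_ext /word_monom msuppU oner_eq0 big_seq_fset1.
by rewrite mcoeffUU scale1r.
Qed.

End Monomials.

(** * Division of polynomials *)

Section RevCoef.
Context (R : nzRingType).
Implicit Types (f g : {poly R}).

(** The coefficients of a polynomial of degree [D] from the leading one
    downwards: in a polynomial that is homogeneous together with its variable,
    this numbering is the degree of the coefficient. *)
Definition revcoef D f k : R := if (k <= D)%N then f`_(D - k) else 0.

Lemma revcoefM K L f g k : (size f <= K.+1)%N -> (size g <= L.+1)%N ->
  (k <= K + L)%N ->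
  revcoef (K + L) (f * g) k =
    \sum_(i < K.+1) revcoef K f i * (if (i <= k)%N then revcoef L g (k - i) else 0).
Proof.
move=> szf szg le_k; rewrite /revcoef le_k.
have fE : f = \poly_(i < K.+1) f`_i.
  apply/polyP => i; rewrite coef_poly; case: ltnP => // le_i.
  by rewrite nth_default // (leq_trans szf).
rewrite {1}fE poly_def mulr_suml coef_sum (reindex_inj rev_ord_inj) /=.
apply: eq_bigr => i _; rewrite subSS -scalerAl coefZ coefXnM.
have /[1!ltnS] iK := ltn_ord i; rewrite iK; congr (_ * _).
case: (leqP i k) => ik; last first.
  by case: ltnP => // _; rewrite nth_default // (leq_trans szg); lia.
case: ltnP => lt1; case: leqP => lt2 //; try lia.
by congr (g`_ _); lia.
Qed.
End RevCoef.

Section RmodpLemmas.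
Context (R : nzRingType).
Implicit Types (f d q : {poly R}).

Lemma rmodp_rmodp_mul q d f : d \is monic -> q * d \is monic ->
  rmodp (rmodp f (q * d)) d = rmodp f d.
Proof.
move=> dm qdm; rewrite [in RHS](rdivp_eq qdm f) mulrA rmodpD //.
by rewrite rmodp_mull // add0r.
Qed.

(** Remainders of differences telescope: this compares the relations between
    three vertices of a chain. *)
Lemma rmodp_shift_diff d (a b c : {poly R}) m n : d \is monic ->
  rmodp (a - 'X^m * b) d =
    rmodp (a - 'X^(m + n) * c) d - rmodp ('X^m * rmodp (b - 'X^n * c) d) d.
Proof.
move=> dm; rewrite rmodp_mulmr // -rmodpB //; congr (rmodp _ d).
by rewrite mulrBr exprD mulrA opprB addrA subrK.
Qed.

Lemma revcoefB D f d k : revcoef D (f - d) k = revcoef D f k - revcoef D d k.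
Proof. by rewrite /revcoef; case: ifP; rewrite ?coefB ?subr0. Qed.

Lemma size_rdivp_monic d f K L : d \is monic -> size d = L.+1 ->
  (size f <= K + L)%N -> (size (rdivp f d) <= K)%N.
Proof.
move=> dm szd szf; have [->|q0] := eqVneq (rdivp f d) 0; first by rewrite size_poly0.
have qd : rdivp f d * d = f - rmodp f d by rewrite {2}(rdivp_eq dm f) addrK.
have szr : (size (rmodp f d) <= L)%N by rewrite -ltnS -szd ltn_rmodpN0 // monic_neq0.
have : (size (f - rmodp f d)%R <= K + L)%N.
  by rewrite (leq_trans (size_polyD _ _)) // geq_max szf size_polyN (leq_trans szr) ?leq_addl.
by rewrite -qd size_Mmonic // szd addnS /= leq_add2r.
Qed.

Lemma revcoef_divE K L f d k : d \is monic -> size d = L.+1 -> (size f <= K + L)%N ->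
  (k <= K + L)%N ->
  revcoef (K + L) f k - revcoef (K + L) (rmodp f d) k =
    \sum_(i < K.+1) revcoef K (rdivp f d) i * (if (i <= k)%N then revcoef L d (k - i) else 0).
Proof.
move=> dm szd szf kKL; rewrite -revcoefB -revcoefM ?szd //.
  by rewrite {1}(rdivp_eq dm f) addrK.
by rewrite ltnW // ltnS; apply: size_rdivp_monic szd _.
Qed.
End RmodpLemmas.

(** A single step of the division algorithm. *)
Lemma rmodp_sub_lead (R : nzRingType) (f d : {poly R}) L : d \is monic ->
  size d = L.+1 -> (size f <= L.+1)%N -> rmodp f d = f - f`_L *: d.
Proof.
move=> dm szd szf; rewrite -[in LHS](subrK (f`_L *: d) f) addrC -mul_polyC.
rewrite rmodp_addl_mul_small // szd ltnS; apply/leq_sizeP => i.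
have dL : d`_L = 1 by have /monicP := dm; rewrite lead_coefE szd.
rewrite mul_polyC coefB coefZ leq_eqVlt => /orP[/eqP<-|lt_i].
  by rewrite dL mulr1 subrr.
by rewrite [f`_i]nth_default ?(leq_trans szf) // [d`_i]nth_default ?szd // mulr0 subr0.
Qed.

(** * Polynomials attached to paths and vertices *)

Section AlgebraBasics.
Context (F : fieldType) (G : layered_graph).
Local Notation freeAlg := {malg F[{fmonom (edge G)}]}.
Local Notation A := (graphAlg F G).
Local Notation pi := (@graphAlg_pi F G).

Lemma graphAlg_pi_is_linear : linear pi.
Proof. by move=> a x y; rewrite graphAlg_piD graphAlg_piZ. Qed.
HB.instance Definition _ :=
  GRing.isLinear.Build F freeAlg A *:%R pi graphAlg_pi_is_linear.

Lemma graphAlg_pi_is_monoid_morphism : monoid_morphism pi.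
Proof. by split=> [//|x y]; rewrite graphAlg_piM. Qed.
HB.instance Definition _ :=
  GRing.isMonoidMorphism.Build freeAlg A pi graphAlg_pi_is_monoid_morphism.

Definition monom_class n (a : A) := exists2 s, size s = n & a = pi (word_monom F s).

Lemma graphAlg_compP n a : graphAlg_comp n a <-> lspan (monom_class n) a.
Proof.
split=> [[x x_n ->]|].
  apply: lspan_linear (malg_span x) => _ [s /x_n sn ->]; apply: lspan_mem.
  by exists s.
elim=> {a} [_ [s sn ->]||_ _ _ [x xn ->] _ [y yn ->]|c _ _ [x xn ->]].
- by exists (word_monom F s) => // k; rewrite msuppU1 in_fset1 => /eqP->.
- by exists 0; [move=> k; rewrite msupp0|rewrite linear0].
- exists (x + y); rewrite ?linearD // => k /(fsubsetP (msuppD_le x y)).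
  by rewrite in_fsetU => /orP[/xn|/yn].
- by exists (c *: x); rewrite ?linearZ // => k /(fsubsetP (msuppZ_le c x))/xn.
Qed.

Lemma graphAlg_compM i j (a b : A) : graphAlg_comp i a -> graphAlg_comp j b ->
  graphAlg_comp (i + j) (a * b).
Proof.
move=> /graphAlg_compP ai /graphAlg_compP bj; apply/graphAlg_compP.
apply: lspan_mul (@scalerAr _ _) _ ai bj => _ _ [s <- ->] [s' <- ->]; apply: lspan_mem.
by exists (s ++ s'); rewrite ?size_cat // word_monom_cat rmorphM.
Qed.

Lemma graphAlg_comp1 : graphAlg_comp 0 (1 : A).
Proof.
apply/graphAlg_compP/lspan_mem; exists [::] => //.
by rewrite word_monom0 rmorph1.
Qed.

Lemma path_poly_homogeneous (p : seq (edge G)) j :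
  lspan (fun x => exists2 s, (size s + j = size p)%N & x = word_monom F s)
    (path_poly F p)`_j.
Proof.
elim: p j => [|e p IHp] j; rewrite /path_poly.
  rewrite big_nil coef1; case: eqP => [->|_]; last exact: lspan0.
  by apply: lspan_mem; exists [::]; rewrite ?word_monom0.
rewrite big_cons -/(path_poly F p) mulrBl coefB coefXM coefCM; apply: lspanB.
  case: j => [|j] /=; first exact: lspan0.
  by apply: lspan_mono (IHp j) => x [s sp ->]; exists s; rewrite // addnS sp.
have -> : gen F e = word_monom F [:: e].
  by rewrite /gen /word_monom fmuE.
apply: (@lspan_mul _ _ (fun x => x = word_monom F [:: e])) (@freeAlg_scalerAr _ _) _ _ (IHp j).
  move=> _ _ -> [s sp ->]; apply: lspan_mem; exists (e :: s) => /=.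
    by rewrite addSn sp.
  by rewrite -word_monom_cat.
exact: lspan_mem.
Qed.

Definition pathP p : {poly A} := \prod_(e <- p) ('X - (pi (gen F e))%:P).

Lemma map_path_poly p : map_poly pi (path_poly F p) = pathP p.
Proof.
rewrite /path_poly rmorph_prod; apply: eq_bigr => e _.
by rewrite rmorphB /= map_polyX map_polyC.
Qed.

Lemma pathP_monic p : pathP p \is monic.
Proof. by rewrite rpred_prod // => e _; apply: monicXsubC. Qed.

Lemma size_pathP p : size (pathP p) = (size p).+1.
Proof. by rewrite /pathP size_prod_XsubC. Qed.

Lemma pathP_cat p q : pathP (p ++ q) = pathP p * pathP q.
Proof. by rewrite /pathP big_cat. Qed.

(** This is what the defining relations of the algebra say. *)
Lemma pathP_eq (u v : vposet G) p q : dipath u p v -> dipath u q v -> pathP p = pathP q.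
Proof.
move=> upv uqv; apply/polyP => m; rewrite -!map_path_poly !coef_map /=.
apply/graphAlg_piP/rel_idealP/IdealGen; exists u, v, p, q, m; split=> //.
by apply: (@addIn (level v)); rewrite (dipath_size upv) (dipath_size uqv).
Qed.

End AlgebraBasics.

Section VertexPolynomials.
Context (F : fieldType) (G : layered_graph) (hmin : unique_minimal G).
Local Notation A := (graphAlg F G).
Local Notation pi := (@graphAlg_pi F G).
Implicit Types (u v w : vposet G).

Definition vpoly v : {poly A} := pathP F (descent hmin v).

Lemma vpoly_monic v : vpoly v \is monic.
Proof. exact: pathP_monic. Qed.

Lemma size_vpoly v : size (vpoly v) = (level v).+1.
Proof. by rewrite size_pathP size_descent. Qed.

Lemma vpoly_bottom v : level v = 0%N :> nat -> vpoly v = 1.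
Proof. by move=> v0; rewrite /vpoly descent_bottom // /pathP big_nil. Qed.

(** Any path may replace the chosen one, in particular one that passes
    through [u]. *)
Lemma vpolyE v p u : dipath v p u -> vpoly v = pathP F p * vpoly u.
Proof.
move=> vpu; have := dipath_level vpu => lt_uv.
have [|b b0 vb] := @dipath_descent _ hmin v; first by rewrite -lt0n; lia.
have [u0|/(dipath_descent hmin)[b' b'0 ub']] := eqVneq (nat_of_ord (level u)) 0%N.
  rewrite (vpoly_bottom u0) mulr1; apply: (pathP_eq _ vb).
  by rewrite (bottom_unique hmin b0 u0).
rewrite -pathP_cat; apply: (pathP_eq _ vb).
by rewrite (bottom_unique hmin b0 b'0); apply: dipath_cat ub'.
Qed.

(** These elements, for [1 <= k <= level v], replace the edges as generators. *)
Definition vcoef v k : A := revcoef (level v) (vpoly v) k.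

Lemma vcoef0 v : vcoef v 0 = 1.
Proof.
have /monicP := vpoly_monic v.
by rewrite /vcoef /revcoef /= subn0 lead_coefE size_vpoly.
Qed.

Lemma vcoef_gt v k : (level v < k)%N -> vcoef v k = 0.
Proof. by rewrite /vcoef /revcoef ltnNge => /negPf ->. Qed.

Lemma vcoef_comp v k : graphAlg_comp k (vcoef v k).
Proof.
apply/graphAlg_compP; rewrite /vcoef /revcoef; case: leqP => [kv|_]; last exact: lspan0.
rewrite /vpoly -map_path_poly coef_map /=.
apply: lspan_linear (path_poly_homogeneous F _ _) => _ [s + ->].
rewrite size_descent => sk; apply: lspan_mem; exists s => //; lia.
Qed.

Lemma vcoef1_edge (e : edge G) :
  vcoef (tail e) 1 - vcoef (head e) 1 = - pi (gen F e).
Proof.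
have te : dipath (tail e) [:: e] (head e) by [].
rewrite {1}/vcoef /revcoef (vpolyE te) /pathP big_seq1 level_tail /= subSS subn0.
rewrite mulrBl coefB coefXM coefCM.
have -> : (vpoly (head e))`_(level (head e)) = 1.
  by rewrite -(vcoef0 (head e)) /vcoef /revcoef /= subn0.
rewrite mulr1 /vcoef /revcoef; case: (nat_of_ord _) => [|n] /=.
  by rewrite sub0r subr0.
by rewrite subn1 addrAC subrr sub0r.
Qed.

End VertexPolynomials.

(** * Reduction to normal words *)

Section RightAction.
Context (F : fieldType) (A : lalgType F) (X : lmodType F).

(** Words are reduced both in the algebra, acting on itself, and in a free
    right module over it; the two cases share this interface. *)
Record right_action (act : X -> A -> X) : Prop := RightAction {
  act_linear_l : forall a, linear (act^~ a);
  act_linear_r : forall x, linear (act x);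
  act1 : forall x, act x 1 = x;
  actM : forall x a b, act x (a * b) = act (act x a) b
}.

Context (act : X -> A -> X) (act_right : right_action act).

Lemma act0 x : act x 0 = 0.
Proof.
by have := act_linear_r act_right x (-1) 0 0; rewrite !scaleN1r oppr0 addr0 addNr.
Qed.

Lemma act_0l a : act 0 a = 0.
Proof.
have := act_linear_l act_right a (-1) 0 0.
by rewrite !scaleN1r oppr0 addr0 addNr.
Qed.

Lemma actBl x y a : act (x - y) a = act x a - act y a.
Proof.
have := act_linear_l act_right a (-1) y x.
by rewrite !scaleN1r [- y + x]addrC => ->; rewrite addrC.
Qed.

End RightAction.

Lemma right_action_mul (F : fieldType) (A : algType F) :
  right_action (fun x a : A => x * a).
Proof.
split=> [a k x y|x k a b|x|x a b]; last exact: mulrA.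
- by rewrite mulrDl scalerAl.
- by rewrite mulrDr scalerAr.
- exact: mulr1.
Qed.

Section Junction.
Context (F : fieldType) (G : layered_graph) (hmin : unique_minimal G).
Local Notation A := (graphAlg F G).
Context (X : lmodType F) (act : X -> A -> X) (act_right : right_action act).
Context (P : nat -> nat -> X -> Prop).
Local Notation Fil s n := (lspan (P s n)).
Context (u v : vposet G) (rho z : nat -> X).
Local Notation c := (@vcoef F G hmin u).
Local Notation K := (level v - level u)%N.

Hypothesis P_mono : forall s s' n x, (s <= s')%N -> P s n x -> P s' n x.
Hypothesis FilM : forall s n x l, letter_ok (u, l) -> Fil s n x ->
  Fil (s + weight u l) (n + l) (act x (c l)).
Hypothesis lt_uv : (level u < level v)%N.
Hypothesis Fil_rho : forall k, letter_ok (v, k) -> Fil (weight v k).+1 k (rho k).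
Hypothesis Fil_z0 : forall k, letter_ok (u, k) ->
  Fil (weight u k).+1 k (act (z 0%N) (c k)).
Hypothesis division : forall k, letter_ok (v, k) ->
  Fil 0 k (rho k -
    \sum_(i < K.+1) (if (i <= k)%N then act (z i) (c (k - i)) else 0)).

Let Fil_mono s s' n x : (s <= s')%N -> Fil s n x -> Fil s' n x.
Proof. by move=> le_s; apply: lspan_mono => y; apply: P_mono. Qed.

Let lower_term j m : (j < K)%N -> (0 < m)%N ->
  ((0 < j)%N -> Fil (weight v j).+1 j (z j)) ->
  Fil (weight v (j + m)) (j + m) (act (z j) (c m)).
Proof.
move=> jK m0 Fil_zj; have [um|mu] := ltnP (level u) m.
  by rewrite vcoef_gt // (act0 act_right); apply: lspan0.
have ok_um : letter_ok (u, m) by rewrite /letter_ok /= m0.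
have lt_w : (weight v j + weight u m < weight v (j + m))%N.
  by apply: weight_cat_lt; lia.
have [j0|/Fil_zj/(FilM ok_um)] := posnP j.
  rewrite j0 add0n; apply: Fil_mono (Fil_z0 ok_um).
  by move: lt_w; rewrite j0 /weight big_ord0 !add0n.
exact: Fil_mono.
Qed.

(** Here [rho] lists the coefficients of a polynomial of degree [level v]
    that is divisible by the polynomial of [u], up to elements that lie in
    every step of the filtration, and [z] lists those of the quotient; [P s n]
    stands for elements of degree [n] and weight less than [s].  Since the
    divisor is monic, [rho i] is [z i] plus products [z j * c (i - j)] with
    [j < i], whose weight is smaller because [u] lies at least [K] levels
    below [v]. *)
Lemma quotient_leading i : (0 < i <= K)%N -> Fil (weight v i) i (z i - rho i).
Proof.
elim/ltn_ind: i => i IHi /andP[i0 iK].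
have ok_i : letter_ok (v, i) by rewrite /letter_ok /= i0; lia.
have /lspanN := division ok_i; rewrite opprB.
have lt_i : (i < K.+1)%N by [].
rewrite (bigD1 (Ordinal lt_i)) //= leqnn subnn vcoef0 (act1 act_right).
move/(Fil_mono (leq0n (weight v i))); set S := \sum_(j < _ | _) _ => Fil_S.
have -> : z i - rho i = z i + S - rho i - S by rewrite addrAC addrK.
apply: lspanB => //; apply: lspan_sum => j; rewrite -val_eqE /= => ji.
case: ifP => [le_ji|_]; last exact: lspan0.
have {1 2}-> : i = (j + (i - j))%N by lia.
apply: lower_term; try lia.
move=> j0; have -> : z j = z j - rho j + rho j by rewrite subrK.
apply: lspanD; last by apply: Fil_rho; rewrite /letter_ok /= j0; lia.
by apply: Fil_mono (IHi j _ _); lia.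
Qed.

(** In the coefficient of index [K + l] of the product of the quotient and the
    polynomial of [u], the term [z K * c l] dominates, the others starting
    again from the level of [u] too early. *)
Lemma junction l : letter_ok (u, l) ->
  Fil (weight v (K + l)) (K + l) (act (rho K) (c l) - rho (K + l)%N).
Proof.
move=> ok_l; have [/= l0 lu] := andP ok_l.
have ok_Kl : letter_ok (v, (K + l)%N) by rewrite /letter_ok /=; lia.
have /(Fil_mono (leq0n (weight v (K + l)))) := division ok_Kl.
rewrite big_ord_recr /= leq_addr addKn => Fil_S.
set S := \sum_(j < K) _ in Fil_S.
have -> : act (rho K) (c l) - rho (K + l)%N =
    - (rho (K + l)%N - (S + act (z K) (c l))) - S - act (z K - rho K) (c l).
  rewrite (actBl act_right) !opprB [S + _]addrC [_ - S]addrAC addrK.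
  by rewrite [RHS]addrC addrA subrK.
apply: lspanB; last first.
  rewrite -(@weight_cat _ u); last by lia.
  by apply: FilM => //; apply: quotient_leading; lia.
apply: lspanB; first exact: lspanN.
apply: lspan_sum => j _; case: ifP => [le_ji|_]; last exact: lspan0.
have ltj := ltn_ord j.
have {1 2}-> : (K + l)%N = (j + (K + l - j))%N by lia.
apply: lower_term => //; try lia.
move=> j0; have -> : z j = z j - rho j + rho j by rewrite subrK.
apply: lspanD; last by apply: Fil_rho; rewrite /letter_ok /= j0; lia.
by apply: Fil_mono (quotient_leading _); lia.
Qed.

End Junction.

Lemma mul_split (R : pzRingType) (x y z t r : R) :
  x * (y * (z * t)) = x * (y * z - r) * t + x * (r * t).
Proof. by rewrite mulrBr mulrBl !mulrA subrK. Qed.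

Section Reduction.
Context (F : fieldType) (G : layered_graph) (hmin : unique_minimal G).
Local Notation A := (graphAlg F G).
Local Notation c := (@vcoef F G hmin).
Implicit Types (u v w : vposet G) (z : seq (letter G)).

Definition word_val z : A := \prod_(a <- z) c a.1 a.2.

Lemma word_val0 : word_val [::] = 1.
Proof. exact: big_nil. Qed.

Lemma word_val_cons a z : word_val (a :: z) = c a.1 a.2 * word_val z.
Proof. exact: big_cons. Qed.

Lemma word_val_cat z z' : word_val (z ++ z') = word_val z * word_val z'.
Proof. exact: big_cat. Qed.

Lemma word_val_comp z : graphAlg_comp (wdeg z) (word_val z).
Proof.
elim: z => [|a z IHz]; first by rewrite word_val0 /wdeg big_nil; apply: graphAlg_comp1.
rewrite word_val_cons wdeg_cons; apply: graphAlg_compM IHz; exact: vcoef_comp.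
Qed.

Definition word_class s n (a : A) :=
  exists z, [/\ all (@letter_ok G) z, wdeg z = n, (wweight z < s)%N & a = word_val z].

Lemma word_class_mul z1 z2 s n a :
  all (@letter_ok G) z1 -> all (@letter_ok G) z2 -> lspan (word_class s n) a ->
  lspan (word_class (wweight z1 + s + wweight z2) (wdeg z1 + n + wdeg z2))
    (word_val z1 * a * word_val z2).
Proof.
move=> ok1 ok2.
apply: (@lspan_map _ _ _ _ _ (fun a => word_val z1 * a * word_val z2)) => [|_ [z [okz <- lt_s ->]]].
  by move=> k x y; rewrite mulrDr mulrDl -scalerAr -scalerAl.
apply: lspan_mem; exists (z1 ++ z ++ z2); split.
- by rewrite !all_cat ok1 okz.
- by rewrite !wdeg_cat addnA.
- by rewrite !wweight_cat -addnA ltn_add2l ltn_add2r.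
- by rewrite !word_val_cat mulrA.
Qed.

(** The quotient of the polynomial of [v] by the one of a vertex [u] below
    it is the polynomial of any path from [v] to [u]. *)
Definition vquo v u k : A :=
  revcoef (level v - level u) (rdivp (vpoly F hmin v) (vpoly F hmin u)) k.

Lemma vpoly_divE v u : (u < v)%O -> exists2 p, size p = (level v - level u)%N &
  rdivp (vpoly F hmin v) (vpoly F hmin u) = pathP F p /\
  vpoly F hmin v = pathP F p * vpoly F hmin u.
Proof.
case/asboolP=> p vpu; exists p; first by rewrite -(dipath_size vpu) addnK.
by rewrite (vpolyE F hmin vpu) rdivp_mull // vpoly_monic.
Qed.

Lemma vquo0 v u : (u < v)%O -> vquo v u 0 = 1.
Proof.
case/vpoly_divE => p szp [E _]; rewrite /vquo E /revcoef /= subn0 -szp.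
by have /monicP := pathP_monic F p; rewrite lead_coefE size_pathP.
Qed.

Lemma vcoef_division v u k : (u < v)%O -> (k <= level v)%N ->
  c v k = \sum_(i < (level v - level u).+1)
    (if (i <= k)%N then vquo v u i * c u (k - i) else 0).
Proof.
move=> uv kv; have lt_uv := lt_level uv; have [p szp [Ep E]] := vpoly_divE uv.
have lev_eq : (level v = (level v - level u) + level u :> nat)%N by rewrite subnK // ltnW.
rewrite {1}/vcoef E {1}lev_eq revcoefM; first last.
- by rewrite -lev_eq.
- by rewrite size_vpoly.
- by rewrite size_pathP szp.
by apply: eq_bigr => i _; rewrite /vquo Ep; case: ifP; rewrite ?mulr0.
Qed.

(** The quotient being a polynomial in the algebra, with leading coefficient
    [1], the junction lemma applies to the vertex polynomials themselves. *)
Lemma vcoef_junction u v l : (u < v)%O -> letter_ok (u, l) ->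
  lspan (word_class (weight v (level v - level u + l)) (level v - level u + l))
    (c v (level v - level u) * c u l - c v (level v - level u + l)).
Proof.
move=> uv; have lt_uv := lt_level uv.
have wc1 w k : letter_ok (w, k) -> lspan (word_class (weight w k).+1 k) (c w k).
  move=> ok_wk; apply: lspan_mem; exists [:: (w, k)]; split.
  - by rewrite /= ok_wk.
  - by rewrite /wdeg big_seq1.
  - by rewrite /wweight big_seq1.
  - by rewrite /word_val big_seq1.
apply: (@junction _ _ _ _ _ (@right_action_mul F A) _ _ _ (c v) (vquo v u)) => //.
- move=> s s' n _ le_s [z [okz zn lt_s ->]]; exists z; split=> //.
  exact: leq_trans le_s.
- move=> s n x m ok_m Fx.
  have := @word_class_mul [::] [:: (u, m)] s n x isT; rewrite /= ok_m => /(_ isT Fx).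
  by rewrite word_val0 word_val_cons word_val0 mulr1 mul1r /wweight /wdeg !big_seq1 !big_nil.
- exact: wc1.
- by move=> k ok_k; rewrite vquo0 // mul1r; apply: wc1.
- by move=> k /andP[_ kv]; rewrite (vcoef_division uv kv) subrr; apply: lspan0.
Qed.

Section Module.
Context (X : lmodType F) (act : X -> A -> X) (act_right : right_action act).
Context (N : nat -> X -> Prop) (V : {pred vposet G}) (rho : vposet G -> nat -> X).

Hypothesis N_act : forall m n x a, N n x -> graphAlg_comp m a -> N (n + m) (act x a).

(** The first letter of a word is evaluated by [rho] in the right module, the
    others in the algebra.  [V] is the set of vertices allowed in first
    position, and [N] a graded submodule that is neglected.  The algebra itself
    is the case where all vertices are allowed and nothing is neglected. *)
Definition rho_class s n x := N n x \/ exists v k z,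
  [/\ v \in V, all (@letter_ok G) ((v, k) :: z), wdeg ((v, k) :: z) = n,
      (wweight ((v, k) :: z) < s)%N & x = act (rho v k) (word_val z)].

Definition normal_class n x := N n x \/ exists v k z,
  [/\ v \in V, (v, k) :: z \in normal_words_from v n
    & x = act (rho v k) (word_val z)].

Lemma rho_class_mono s s' n x : (s <= s')%N -> rho_class s n x -> rho_class s' n x.
Proof.
move=> le_s [Nx|[v [k [z [Vv ok zn lt_s ->]]]]]; [by left|right].
by exists v, k, z; split=> //; apply: leq_trans le_s.
Qed.

Lemma rho_class_act s n x z : all (@letter_ok G) z -> lspan (rho_class s n) x ->
  lspan (rho_class (s + wweight z) (n + wdeg z)) (act x (word_val z)).
Proof.
move=> okz; apply: (lspan_map (act_linear_l act_right _)) => y [Ny|].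
  by apply: lspan_mem; left; apply: N_act Ny (word_val_comp z).
case=> v [k [z' [Vv ok <- lt_s ->]]]; apply: lspan_mem; right.
exists v, k, (z' ++ z); split=> //.
- by rewrite -cat_cons all_cat ok.
- by rewrite -cat_cons wdeg_cat.
- by rewrite -cat_cons wweight_cat ltn_add2r.
- by rewrite word_val_cat (actM act_right).
Qed.

Lemma rho_class_rho v k : v \in V -> letter_ok (v, k) ->
  lspan (rho_class (weight v k).+1 k) (rho v k).
Proof.
move=> Vv ok; apply: lspan_mem; right; exists v, k, [::].
rewrite /= ok /wdeg /wweight !big_seq1; split=> //.
by rewrite word_val0 (act1 act_right).
Qed.

Section Division.
Context (quo : vposet G -> vposet G -> nat -> X).
Hypothesis quo0 : forall v u k, v \in V -> (u < v)%O -> letter_ok (u, k) ->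
  lspan (rho_class (weight u k).+1 k) (act (quo v u 0%N) (c u k)).
Hypothesis division : forall v u k, v \in V -> (u < v)%O -> letter_ok (v, k) ->
  lspan (N k) (rho v k - \sum_(i < (level v - level u).+1)
    (if (i <= k)%N then act (quo v u i) (c u (k - i)) else 0)).

Lemma rho_junction u v l : v \in V -> (u < v)%O -> letter_ok (u, l) ->
  lspan (rho_class (weight v (level v - level u + l)) (level v - level u + l))
    (act (rho v (level v - level u)) (c u l) - rho v (level v - level u + l)).
Proof.
move=> Vv uv; apply: (@junction _ _ _ _ _ act_right _ _ _ (rho v) (quo v u)).
- exact: rho_class_mono.
- move=> s n x m ok_m Fx.
  have := @rho_class_act s n x [:: (u, m)]; rewrite /= ok_m => /(_ isT Fx).
  by rewrite word_val_cons word_val0 mulr1 /wweight /wdeg !big_seq1.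
- exact: lt_level.
- by move=> k ok_k; apply: rho_class_rho.
- by move=> k; apply: quo0.
- move=> k ok_k; apply: lspan_mono (division Vv uv ok_k) => y Ny; by left.
Qed.

(** Normal words suffice: a clash is traded for the merged letter, which has
    the same weight and shortens the word, and for words of smaller weight. *)
Theorem normal_words_span v k z : v \in V -> all (@letter_ok G) ((v, k) :: z) ->
  lspan (normal_class (wdeg ((v, k) :: z))) (act (rho v k) (word_val z)).
Proof.
have [s] := ubnP (wweight ((v, k) :: z)).
elim: s v k z => // s IHs v k z.
have [m] := ubnP (size z); elim: m v k z => // m IHm v k z lt_m lt_s Vv ok_vkz.
have lower n x : lspan (rho_class (wweight ((v, k) :: z)) n) x -> lspan (normal_class n) x.
  apply: lspan_trans => y [Ny|[v' [k' [z' [Vv' ok' <- lt' ->]]]]].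
    by apply: lspan_mem; left.
  by apply: IHs => //; apply: leq_trans lt' lt_s.
have [nz|/not_normalP[z1 [[v1 k1] [[u l] [z2 [zE]]]]]] := boolP (normal ((v, k) :: z)).
  apply: lspan_mem; right; exists v, k, z; split=> //.
  move: ok_vkz nz; rewrite normal_cons wdeg_cons => /andP[ok okz] /andP[hz nz].
  by apply: mem_normal_words_from => //; apply: mem_normal_words.
case/andP=> /= uv1 /eqP k1E; have lt_uv := lt_level uv1.
have [ok1 ok_vk1 ok_ul ok2] : [/\ all (@letter_ok G) z1, letter_ok (v1, k1),
    letter_ok (u, l) & all (@letter_ok G) z2].
  by move: ok_vkz; rewrite zE all_cat /= => /and4P.
have [/= l0 lu] := andP ok_ul.
have ok_merge : letter_ok (v1, (k1 + l)%N) by rewrite /letter_ok /=; move: lt_uv k1E l0 lu; clear; lia.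
have wE : (weight v1 k1 + weight u l = weight v1 (k1 + l))%N.
  by apply: weight_cat; move: lt_uv k1E; clear; lia.
case: z1 => [|[v' k'] z1] in zE ok1.
  (* The first letter takes part in the clash, which happens in the module. *)
  case: zE => vE kE zE; rewrite zE in ok_vkz lt_m lt_s lower *.
  rewrite -vE -kE in k1E uv1 ok_merge wE *.
  rewrite !wdeg_cons /= addnA word_val_cons (actM act_right) /=.
  set x := act (rho v k) _; have -> : x = x - rho v (k + l)%N + rho v (k + l)%N.
    by rewrite subrK.
  rewrite -[_ - _]scale1r (act_linear_l act_right) scale1r; apply: lspanD.
    apply: lower; rewrite !wweight_cons /= addnA wE /x k1E.
    by apply: rho_class_act => //; apply: rho_junction.
  rewrite -(wdeg_cons (v, (k + l)%N)); apply: IHm => //; rewrite /= ?ok_merge //.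
  by move: lt_s; rewrite !wweight_cons /= addnA wE.
(* Otherwise the clash happens inside the algebra. *)
case: zE => _ _ zE; have [ok_z1 ok_vk] : all (@letter_ok G) z1 /\ letter_ok (v, k).
  by move: ok1 ok_vkz => /= /andP[_ ->] /andP[].
have -> : word_val z = word_val z1 * (c v1 k1 * c u l - c v1 (k1 + l)%N) * word_val z2
    + word_val (z1 ++ (v1, (k1 + l)%N) :: z2).
  rewrite zE !word_val_cat !word_val_cons /=; exact: mul_split.
rewrite -[_ * _ * _]scale1r (act_linear_r act_right) scale1r; apply: lspanD.
  have := word_class_mul ok_z1 ok2 (vcoef_junction uv1 ok_ul); rewrite -k1E => Fa.
  apply: lower; move: Fa; rewrite zE wweight_cons wweight_cat !wweight_cons /=.
  rewrite wdeg_cons wdeg_cat !wdeg_cons /=.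
  apply: (lspan_map (act_linear_r act_right _)) => _ [y [oky ydeg lt_y ->]].
  apply: lspan_mem; right; exists v, k, y; split=> //.
  - by rewrite /= ok_vk.
  - by rewrite wdeg_cons ydeg /=; clear; lia.
  - by rewrite wweight_cons /=; move: wE lt_y; clear; lia.
have -> : wdeg ((v, k) :: z) = wdeg ((v, k) :: z1 ++ (v1, (k1 + l)%N) :: z2).
  by rewrite zE !wdeg_cons !wdeg_cat !wdeg_cons /=; clear; lia.
apply: IHm => //.
- by move: lt_m; rewrite zE !size_cat /=; clear; lia.
- by move: lt_s; rewrite zE !wweight_cons !wweight_cat !wweight_cons /=; move: wE; clear; lia.
- by rewrite /= ok_vk all_cat ok_z1 /= ok_merge.
Qed.
End Division.
End Module.

Definition ok_word_val n (a : A) :=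
  exists z, [/\ all (@letter_ok G) z, wdeg z = n & a = word_val z].

(** An edge is a difference of two coefficients [c _ 1], and at the bottom
    vertex this coefficient is zero. *)
Lemma graphAlg_word_span n (a : A) : graphAlg_comp n a -> lspan (ok_word_val n) a.
Proof.
move/graphAlg_compP; apply: lspan_trans => _ [s <- ->] {n a}.
elim: s => [|e s IHs].
  rewrite word_monom0 rmorph1; apply: lspan_mem; exists [::].
  by rewrite /wdeg big_nil word_val0.
rewrite -cat1s word_monom_cat graphAlg_piM.
have letter1 w : lspan (ok_word_val 1) (c w 1).
  have [w0|w0] := leqP (level w) 0.
    by rewrite vcoef_gt; [apply: lspan0|apply: leq_ltn_trans w0 _].
  apply: lspan_mem; exists [:: (w, 1%N)]; split.
  - by rewrite /= /letter_ok /= w0.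
  - by rewrite /wdeg big_seq1.
  - by rewrite /word_val big_seq1.
have eE : @graphAlg_pi F G (word_monom F [:: e]) = c (head e) 1 - c (tail e) 1.
  by rewrite -opprB vcoef1_edge opprK /gen /word_monom fmuE.
rewrite eE.
apply: lspan_mul (@scalerAr _ _) _ (lspanB (letter1 _) (letter1 _)) IHs.
move=> _ _ [z [okz dz ->]] [z' [okz' dz' ->]]; apply: lspan_mem.
exists (z ++ z'); split; last by rewrite word_val_cat.
- by rewrite all_cat okz.
- by rewrite wdeg_cat dz dz'.
Qed.

Theorem graphAlg_normal_span n (a : A) : graphAlg_comp n a ->
  lspan (fun x => x \in [seq word_val z | z <- normal_words G n]) a.
Proof.
move/graphAlg_word_span; apply: lspan_trans => _ [[|[v k] z] [okz <- ->]].
  by apply: lspan_mem; rewrite /wdeg big_nil map_f.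
have quo0 v' u j : v' \in predT -> (u < v')%O -> letter_ok (u, j) ->
    lspan (rho_class (fun x a : A => x * a) (fun _ _ => False) predT c (weight u j).+1 j)
      (vquo v' u 0 * c u j).
  move=> _ uv ok_uj; rewrite vquo0 // mul1r.
  exact: (rho_class_rho (@right_action_mul F A)).
have div v' u j : v' \in predT -> (u < v')%O -> letter_ok (v', j) ->
    lspan (fun _ : A => False) (c v' j - \sum_(i < (level v' - level u).+1)
      (if (i <= j)%N then vquo v' u i * c u (j - i) else 0)).
  by move=> _ uv /andP[_ kv]; rewrite (vcoef_division uv kv) subrr; apply: lspan0.
have := normal_words_span (@right_action_mul F A) (fun _ _ _ _ => @False_ind _)
  quo0 div isT okz.
rewrite word_val_cons; apply: lspan_mono => _ [//|[v' [k' [z' [_ vz' ->]]]]].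
rewrite -(word_val_cons (v', k')) map_f // normal_wordsE; last first.
  by case/andP: okz => /andP[/= k0 _] _; rewrite wdeg_cons ltn_addr.
apply/flattenP; exists (normal_words_from v' (wdeg ((v, k) :: z))) => //.
by apply: map_f; rewrite mem_enum.
Qed.
End Reduction.

(** * Homogeneous polynomials over a free right module *)

Section Componentwise.
Context (F : fieldType) (A : algType F) (I : finType).
Local Notation X := {ffun I -> A}.

Definition ffun_act (x : X) (a : A) : X := [ffun i => x i * a].

Lemma right_action_ffun : right_action ffun_act.
Proof.
split=> [a k x y|x k a b|x|x a b]; apply/ffunP => i; rewrite !ffunE.
- by rewrite mulrDl scalerAl.
- by rewrite mulrDr scalerAr.
- by rewrite mulr1.
- by rewrite mulrA.
Qed.

Lemma ffun_actNM x a b : - ffun_act x (a * b) = ffun_act (- ffun_act x a) b.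
Proof. by apply/ffunP => i; rewrite !ffunE mulNr mulrA. Qed.

Definition ffun_coef (f : I -> {poly A}) j : X := [ffun i => (f i)`_j].

Lemma ffun_coef_mulX_add (f : I -> {poly A}) (x : X) (g : {poly A}) j :
  ffun_coef (fun i => 'X * f i + x i *: g) j =
    (if j is j'.+1 then ffun_coef f j' else 0) + ffun_act x g`_j.
Proof.
by case: j => [|j]; apply/ffunP => i; rewrite !ffunE coefD coefXM coefZ.
Qed.

Lemma ffun_coefB (f g : I -> {poly A}) j :
  ffun_coef (fun i => f i - g i) j = ffun_coef f j - ffun_coef g j.
Proof. by apply/ffunP => i; rewrite !ffunE coefB. Qed.

Context (comp : nat -> A -> Prop) (N : nat -> X -> Prop).
Hypothesis N_span : forall n x, lspan (N n) x -> N n x.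
Hypothesis N_act : forall m n x a, N n x -> comp m a -> N (n + m) (ffun_act x a).

(** The variable has degree one, so the coefficient of ['X^j] in a homogeneous
    polynomial of degree [D] has degree [D - j].  Polynomials over the free
    module are given by their coordinates, and [N] is a graded submodule. *)
Definition homog_poly D (g : {poly A}) := forall j,
  ((j <= D)%N -> comp (D - j) g`_j) /\ ((D < j)%N -> g`_j = 0).

Definition homog D (f : I -> {poly A}) := forall j,
  ((j <= D)%N -> N (D - j) (ffun_coef f j)) /\ ((D < j)%N -> ffun_coef f j = 0).

Let N0 n : N n 0.
Proof. exact/N_span/lspan0. Qed.

Let act0r x : ffun_act x 0 = 0.
Proof. exact: (act0 right_action_ffun). Qed.

Let act0l a : ffun_act 0 a = 0.
Proof. exact: (act_0l right_action_ffun). Qed.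

Lemma homogB D f g : homog D f -> homog D g -> homog D (fun i => f i - g i).
Proof.
move=> Nf Ng j; have [Nfj f0] := Nf j; have [Ngj g0] := Ng j.
rewrite ffun_coefB; split=> [jD|jD]; last by rewrite f0 // g0 // subr0.
by apply/N_span/lspanB; apply: lspan_mem; [apply: Nfj|apply: Ngj].
Qed.

Lemma homog_ext D f g : f =1 g -> homog D f -> homog D g.
Proof.
move=> fg Nf j; have -> : ffun_coef g j = ffun_coef f j; last exact: Nf.
by apply/ffunP => i; rewrite !ffunE fg.
Qed.

Lemma homog0 D f : (forall i, f i = 0) -> homog D f.
Proof.
move=> f0 j; have -> : ffun_coef f j = 0 by apply/ffunP => i; rewrite !ffunE f0 coef0.
by split.
Qed.

Lemma homogXn K D f : homog D f -> homog (K + D) (fun i => 'X^K * f i).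
Proof.
move=> Nf j.
have -> : ffun_coef (fun i => 'X^K * f i) j = if (j < K)%N then 0 else ffun_coef f (j - K).
  by case: ifP => jK; apply/ffunP => i; rewrite !ffunE coefXnM jK.
case: ltnP => jK; first by split=> // _; apply: N0.
have [Nfj f0] := Nf (j - K)%N; split=> jD; last by apply: f0; lia.
by have -> : (K + D - j = D - (j - K))%N by [lia]; apply: Nfj; lia.
Qed.

Lemma ffun_coefM (f : I -> {poly A}) g j :
  ffun_coef (fun i => f i * g) j = \sum_(i < j.+1) ffun_act (ffun_coef f i) g`_(j - i).
Proof.
apply/ffunP => i; rewrite !ffunE coefM sum_ffunE.
by apply: eq_bigr => k _; rewrite !ffunE.
Qed.

Section Divisor.
Context (L : nat) (P : {poly A}) (P_monic : P \is monic) (szP : size P = L.+1).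
Hypothesis P_homog : homog_poly L P.

(** The divisor being monic, the coefficients of [f] are recovered one after
    the other from those of the product, starting with the leading one. *)
Lemma homog_cancel D f : homog (D + L) (fun i => f i * P) -> homog D f.
Proof.
move=> NfP.
have [M sz_f] : exists M, forall i, (size (f i) <= M)%N.
  by exists (\max_i size (f i)) => i; apply: leq_bigmax.
suff H d j : (M <= j + d)%N ->
    ((j <= D)%N -> N (D - j) (ffun_coef f j)) /\ ((D < j)%N -> ffun_coef f j = 0).
  by move=> j; apply: (H M); apply: leq_addl.
elim: d j => [|d IHd] j le_M.
  have -> : ffun_coef f j = 0.
    apply/ffunP => i; rewrite !ffunE nth_default //.
    by rewrite (leq_trans (sz_f i)) // -(addn0 j).
  by split=> // _; apply: N0.
have [NfPj fPj0] := NfP (j + L)%N.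
have lt_j : (j < (j + L).+1)%N by rewrite ltnS leq_addr.
have PL : P`_L = 1 by have /monicP := P_monic; rewrite lead_coefE szP.
have fE : ffun_coef f j = ffun_coef (fun i => f i * P) (j + L) -
    \sum_(i < (j + L).+1 | i != Ordinal lt_j) ffun_act (ffun_coef f i) P`_(j + L - i).
  rewrite ffun_coefM (bigD1 (Ordinal lt_j)) //= addKn PL (act1 right_action_ffun).
  by rewrite addrK.
have later (i : 'I_(j + L).+1) : i != Ordinal lt_j ->
    ffun_act (ffun_coef f i) P`_(j + L - i) = 0 \/ (j < i)%N.
  rewrite -val_eqE /= neq_ltn => /orP[lt_ij|]; [left|by right].
  by rewrite nth_default ?act0r // szP; lia.
have iP (i : 'I_(j + L).+1) : (i <= j + L)%N by rewrite -ltnS.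
split=> jD; rewrite fE.
  apply/N_span/lspanB; first by apply: lspan_mem; rewrite -(subnDr L); apply: NfPj; rewrite leq_add2r.
  apply: lspan_sum => i /later[->|lt_ji]; first exact: lspan0.
  have := IHd i; case=> [|Nfi fi0]; first by lia.
  have [iD|/fi0->] := leqP i D; last by rewrite act0l; apply: lspan0.
  apply: lspan_mem; have -> : (D - j = (D - i) + (L - (j + L - i)))%N.
    by have := iP i; lia.
  apply: N_act; first exact: Nfi.
  by have [+ _] := P_homog (j + L - i)%N; apply; have := iP i; lia.
rewrite fPj0 ?ltn_add2r // sub0r big1 ?oppr0 // => i /later[//|lt_ji].
have := IHd i; case=> [|_ ->]; rewrite ?act0l //; lia.
Qed.

Hypothesis comp_span : forall n a, lspan (comp n) a -> comp n a.
Hypothesis compM : forall m n a b, comp m a -> comp n b -> comp (m + n) (a * b).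
Hypothesis comp1 : comp 0 1.

(** The remainder of ['X^(j.+1)] is obtained from that of ['X^j] by one
    multiplication by ['X] and one step of division. *)
Lemma homog_poly_rmodp_Xn j : homog_poly j (rmodp 'X^j P).
Proof.
have comp0 n : comp n 0 by apply/comp_span/lspan0.
elim: j => [|j IHj].
  have [L0|L0] := posnP L.
    have P1 : P = 1.
      have /monicP := P_monic; rewrite lead_coefE szP L0 /= => P0.
      by rewrite [P]size1_polyC ?szP ?L0 // P0.
    by move=> i; rewrite P1 rmodp1 coef0; split=> //.
  rewrite expr0 rmodp_small ?szP ?size_poly1 //.
  move=> i; rewrite coef1; case: i => //= ; split=> // _; exact: comp1.
set r := rmodp 'X^j P in IHj *.
have sz_r : (size r <= L)%N by rewrite -ltnS -szP ltn_rmodpN0 // monic_neq0.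
have [L0|L0] := posnP L.
  have -> : rmodp 'X^(j.+1) P = 0.
    have := @ltn_rmodpN0 _ 'X^(j.+1) P (monic_neq0 P_monic).
    by rewrite szP L0 ltnS leqn0 size_poly_eq0 => /eqP.
  by move=> i; rewrite coef0.
have -> : rmodp 'X^(j.+1) P = 'X * r - r`_L.-1 *: P.
  rewrite exprS -rmodp_mulmr // -/r -[in LHS](subrK (r`_L.-1 *: P) ('X * r)) addrC.
  rewrite -mul_polyC rmodp_addl_mul_small // szP ltnS; apply/leq_sizeP => i.
  rewrite leq_eqVlt => /orP[/eqP<-|lt_i].
    rewrite mul_polyC coefB coefXM coefZ eqn0Ngt L0 /=.
    by have /monicP := P_monic; rewrite lead_coefE szP /= => ->; rewrite mulr1 subrr.
  rewrite mul_polyC coefB coefXM coefZ [P`_i]nth_default ?szP // mulr0 subr0.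
  by case: eqP => // _; rewrite nth_default // (leq_trans sz_r); lia.
move=> i; rewrite coefB coefXM coefZ.
have [Pi P0i] := P_homog i.
have [rL r0L] := IHj L.-1.
split=> ij; last first.
  have -> : (i == 0%N) = false by lia.
  have [_ ->] := IHj i.-1; last by lia.
  have [Li|iL] := ltnP L i; first by rewrite P0i // mulr0 subr0.
  by rewrite r0L ?mul0r ?subr0 //; lia.
apply/comp_span/lspanB; apply: lspan_mem.
  case: eqP => [->|i0]; first exact: comp0.
  have [+ _] := IHj i.-1; have -> : (j - i.-1 = j.+1 - i)%N by lia.
  by apply; lia.
have [iL|Li] := leqP i L; last by rewrite P0i // mulr0; apply: comp0.
have [Lj|jL] := leqP L.-1 j; last by rewrite r0L // mul0r; apply: comp0.
have -> : (j.+1 - i = (j - L.-1) + (L - i))%N by lia.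
by apply: compM; [apply: rL|apply: Pi].
Qed.

(** Taking remainders is left linear, which reduces the claim to the powers of
    the variable. *)
Lemma homog_rmodp D f : homog D f -> homog D (fun i => rmodp (f i) P).
Proof.
move=> Nf m.
have -> : ffun_coef (fun i => rmodp (f i) P) m =
    \sum_(j < D.+1) ffun_act (ffun_coef f j) (rmodp 'X^j P)`_m.
  apply/ffunP => i; rewrite !ffunE sum_ffunE.
  have fiE : f i = \sum_(j < D.+1) (f i)`_j *: 'X^j.
    rewrite -poly_def; apply/polyP => j; rewrite coef_poly; case: ltnP => // lt_D.
    by have [_ /(_ lt_D)/ffunP/(_ i)] := Nf j; rewrite !ffunE.
  rewrite {1}fiE rmodp_sum // coef_sum; apply: eq_bigr => j _.
  by rewrite rmodpZ // coefZ !ffunE.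
have le_jD (j : 'I_D.+1) : (j <= D)%N by rewrite -ltnS.
split=> mD.
  apply/N_span/lspan_sum => j _; apply: lspan_mem.
  have [rj r0] := homog_poly_rmodp_Xn j m.
  have [mj|/r0->] := leqP m j; last by rewrite act0r; apply: N0.
  have -> : (D - m = D - j + (j - m))%N by have := le_jD j; lia.
  by apply: N_act; [have [+ _] := Nf j; apply|apply: rj].
rewrite big1 // => j _; have [_ ->] := homog_poly_rmodp_Xn j m; first exact: act0r.
by apply: leq_ltn_trans mD.
Qed.

End Divisor.
End Componentwise.

(** * Formal vertex polynomials and their relations *)

Section FormalPolynomials.
Context (R : nzRingType) (G : layered_graph).
Implicit Types (v : vposet G).

(** The free generator [Q_{v,k}] of the right module is the slot [(v, k)].
    Slots with [k = 0] or [k > level v] occur only because a single range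
    serves all the vertices. *)
Definition slot : finType := (vposet G * 'I_(top_level G).+1)%type.

(** The coordinates of [Q_v], the sum over [k] of [Q_{v,k} t^(|v| - k)]. *)
Definition formal_poly v (i : slot) : {poly R} :=
  if (i.1 == v) && (0 < i.2 <= level v)%N then 'X^(level v - i.2) else 0.

Lemma formal_poly_bottom v i : level v = 0%N :> nat -> formal_poly v i = 0.
Proof.
rewrite /formal_poly => v0; case: ifP => // /andP[_ /andP[i0 iv]].
by move: (leq_trans i0 iv); rewrite v0.
Qed.

Lemma size_formal_poly v i : (size (formal_poly v i) <= level v)%N.
Proof.
rewrite /formal_poly; case: ifP => [|_]; last by rewrite size_poly0.
by case/andP=> _ /andP[i0 iv]; rewrite size_polyXn; lia.
Qed.

Lemma revcoef_formal_poly v k i : (0 < k <= level v)%N ->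
  revcoef (level v) (formal_poly v i) k = ((i.1 == v) && (i.2 == k :> nat))%:R.
Proof.
case/andP=> /= k0 kv; rewrite /revcoef kv /formal_poly.
case: eqP => [_|_] /=; last by rewrite coef0.
case: (eqVneq (nat_of_ord i.2) k) => [->|ik].
  by rewrite k0 kv coefXn eqxx.
case: ifP => [/andP[i0 iv]|_]; last by rewrite coef0.
by rewrite coefXn; case: eqP => // E; case/eqP: ik; rewrite -(subKn kv) E subKn.
Qed.
End FormalPolynomials.

Section Relations.
Context (F : fieldType) (G : layered_graph) (hmin : unique_minimal G).
Local Notation A := (graphAlg F G).
Local Notation c := (@vcoef F G hmin).
Local Notation vp := (@vpoly F G hmin).
Local Notation comp := (@graphAlg_comp F G).
Implicit Types (u v w : vposet G).

Local Notation X := {ffun slot G -> A}.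

(** In the augmentation ideal, where [Q_v] becomes [P_v - t^|v|], the
    polynomial [P_w] divides [Q_v - t^(|v| - |w|) Q_w] on the right, because it
    divides [P_v].  The relations say that the remainder vanishes. *)
Definition rel_poly v w (i : slot G) : {poly A} :=
  rmodp (formal_poly A v i - 'X^(level v - level w) * formal_poly A w i) (vp w).

Definition rel_coef v w k : X := [ffun i => revcoef (level w) (rel_poly v w i) k].

(** The bound [m] on the level of the smaller vertex provides the filtration
    used to count the relations. *)
Definition rel_gen m n (x : X) := exists v w k a j,
  [/\ (w < v)%O, (level w < m)%N, letter_ok (w, k) &
    [/\ comp j a, (level v - level w + k + j = n)%N & x = ffun_act (rel_coef v w k) a]].

Definition rel_space m n := lspan (rel_gen m n).

Lemma rel_space_span m n x : lspan (rel_space m n) x -> rel_space m n x.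
Proof. exact: lspan_trans. Qed.

Lemma rel_space_act m j n x a : rel_space m n x -> comp j a ->
  rel_space m (n + j) (ffun_act x a).
Proof.
rewrite /rel_space => Nx ja.
apply: (lspan_map (act_linear_l (@right_action_ffun F A (slot G)) a)) Nx.
move=> _ [v [w [k [b [i [wv lt_wm ok_wk [ib <- ->]]]]]]].
apply: lspan_mem; exists v, w, k, (b * a), (i + j)%N.
split; [exact: wv|exact: lt_wm|exact: ok_wk|split].
- exact: graphAlg_compM.
- by rewrite addnA.
- by rewrite (actM (@right_action_ffun F A (slot G))).
Qed.

Lemma graphAlg_comp_span n (a : A) : lspan (comp n) a -> comp n a.
Proof.
move=> na; apply/graphAlg_compP; apply: lspan_trans na => b.
by move/graphAlg_compP.
Qed.

Lemma homog_vpoly u : homog_poly comp (level u) (vp u).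
Proof.
move=> j; split=> ju; last by rewrite nth_default // size_vpoly.
have -> : (vp u)`_j = c u (level u - j) by rewrite /vcoef /revcoef leq_subr subKn.
exact: vcoef_comp.
Qed.

Lemma size_rel_poly v w i : (size (rel_poly v w i) <= level w)%N.
Proof.
by rewrite -ltnS -(size_vpoly F hmin w) ltn_rmodpN0 // monic_neq0 // vpoly_monic.
Qed.

Lemma rel_poly_homog m v w : (w < v)%O -> (level w < m)%N ->
  homog (rel_space m) (level v) (rel_poly v w).
Proof.
move=> wv wm j; have lt_wv := lt_level wv.
have [wj|jw] := leqP (level w) j.
  have -> : ffun_coef (rel_poly v w) j = 0.
    apply/ffunP => i; rewrite !ffunE nth_default //.
    exact: leq_trans (size_rel_poly _ _ _) wj.
  by split=> // _; apply: lspan0.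
split=> [jv|]; last by lia.
apply: lspan_mem; exists v, w, (level w - j)%N, 1, 0%N; split=> //.
  by rewrite /letter_ok /= subn_gt0 jw leq_subr.
split; [exact: graphAlg_comp1|by lia|].
rewrite (act1 (@right_action_ffun F A (slot G))); apply/ffunP => i; rewrite !ffunE.
by rewrite /revcoef leq_subr subKn // ltnW.
Qed.

Lemma homog_rmodp_vpoly m D f u : homog (rel_space m) D f ->
  homog (rel_space m) D (fun i => rmodp (f i) (vp u)).
Proof.
apply: (homog_rmodp (rel_space_span (m := m)) (@rel_space_act m) (vpoly_monic F hmin u)
  (size_vpoly F hmin u) (homog_vpoly u) graphAlg_comp_span).
  exact: graphAlg_compM.
exact: graphAlg_comp1.
Qed.

(** The polynomial of [u] divides that of [w], so the division by the latter
    does not change the remainder modulo the former; what remains are the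
    relations of [u] with [v] and with [w]. *)
Lemma rel_poly_division u v w : (w < v)%O -> (u < w)%O ->
  homog (rel_space (level w)) (level v) (fun i => rmodp (rel_poly v w i) (vp u)).
Proof.
move=> wv uw; have [lt_wv lt_uw] := (lt_level wv, lt_level uw).
have [p _ [_ vpw]] := vpoly_divE F hmin uw.
have uv := lt_trans uw wv.
have lt_K : (level v - level u = level v - level w + (level w - level u))%N by lia.
apply: (@homog_ext _ _ _ _ _ (fun i => rel_poly v u i -
   rmodp ('X^(level v - level w) * rel_poly w u i) (vp u))).
  move=> i; rewrite /rel_poly [in RHS]vpw rmodp_rmodp_mul -?vpw ?vpoly_monic //.
  by rewrite lt_K -rmodp_shift_diff // vpoly_monic.
apply: (homogB (rel_space_span (m := level w))); first exact: rel_poly_homog.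
apply: homog_rmodp_vpoly.
have := homogXn (rel_space_span (m := level w)) (level v - level w)
  (rel_poly_homog uw lt_uw).
by rewrite subnK // ltnW.
Qed.

Definition rel_words v w n : seq X :=
  [seq ffun_act (rel_coef v w (seq.head (v, 0%N) z).2) (word_val F hmin (behead z))
  | z <- normal_words_from w (n - (level v - level w))].

Definition rel_span_words n : seq X :=
  flatten [seq rel_words p.1 p.2 n | p <- enum [pred p : vposet G * vposet G | (p.2 < p.1)%O]].

(** By the division property the coefficients of the remainder attached to
    [w < v] behave, modulo relations of smaller level, like the letters
    [(w, k)]; only normal words starting with [w] are needed. *)
Lemma rel_space_words m n x : rel_space m n x ->
  lspan (fun y => y \in rel_span_words n) x.
Proof.
elim/ltn_ind: m n x => m IHm n x; apply: lspan_trans => {x}.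
move=> _ [v [w [k [a [j [wv lt_wm ok_wk [ja <- ->]]]]]]].
have [/= k0 kw] := andP ok_wk; have lt_wv := lt_level wv.
apply: (lspan_map (act_linear_r (@right_action_ffun F A (slot G)) _) _ (graphAlg_word_span hmin ja)).
move=> _ [z [okz <- ->]].
pose N i := rel_space (level w) (level v - level w + i).
have N_act i i' x b : N i' x -> comp i b -> N (i' + i)%N (ffun_act x b).
  by rewrite /N addnA; apply: rel_space_act.
pose quo u' u i : X :=
  [ffun s => revcoef (level w - level u) (rdivp (rel_poly v w s) (vp u)) i].
have quo0 v' u i : v' \in pred1 w -> (u < v')%O -> letter_ok (u, i) ->
    lspan (rho_class hmin (@ffun_act F A (slot G)) N (pred1 w) (fun _ => rel_coef v w) (weight u i).+1 i)
      (ffun_act (quo v' u 0%N) (c u i)).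
  move=> /eqP-> uw _; have -> : quo w u 0%N = 0.
    apply/ffunP => s; rewrite !ffunE /revcoef /= subn0 nth_default //.
    apply: (size_rdivp_monic (vpoly_monic F hmin u) (size_vpoly F hmin u)).
    by rewrite subnK ?size_rel_poly // ltnW // lt_level.
  by rewrite (act_0l (@right_action_ffun F A (slot G))); apply: lspan0.
have div v' u i : v' \in pred1 w -> (u < v')%O -> letter_ok (v', i) ->
    lspan (N i) (rel_coef v w i - \sum_(l < (level v' - level u).+1)
      (if (l <= i)%N then ffun_act (quo v' u l) (c u (i - l)) else 0)).
  move=> /eqP-> uw /andP[/= i0 iw]; apply: lspan_mem; have lt_uw := lt_level uw.
  have -> : rel_coef v w i - \sum_(l < (level w - level u).+1)
      (if (l <= i)%N then ffun_act (quo w u l) (c u (i - l)) else 0) =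
      ffun_coef (fun s => rmodp (rel_poly v w s) (vp u)) (level w - i)%N.
    apply/ffunP => s; rewrite !ffunE sum_ffunE.
    have wE : (level w = level w - level u + level u :> nat)%N by rewrite subnK // ltnW.
    have := @revcoef_divE A (level w - level u) (level u) (rel_poly v w s) (vp u) i
      (vpoly_monic F hmin u) (size_vpoly F hmin u).
    rewrite -wE size_rel_poly iw => /(_ isT isT).
    rewrite [X in _ - X]/revcoef iw => /(canRL (subrK _)) ->.
    rewrite [X in X - _]addrC -addrA [X in _ + X](_ : _ = 0) ?addr0 //.
    apply/eqP; rewrite subr_eq0; apply/eqP; apply: eq_bigr => l _.
    by case: ifP; rewrite !ffunE ?mulr0.
  have [+ _] := rel_poly_division wv uw (level w - i)%N.
  rewrite /N; have -> : (level v - (level w - i) = level v - level w + i)%N by lia.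
  by apply; lia.
have ok_z : all (@letter_ok G) ((w, k) :: z) by rewrite /= ok_wk.
have := normal_words_span (@right_action_ffun F A (slot G)) N_act quo0 div (eqxx w) ok_z.
have -> : (level v - level w + k + wdeg z = level v - level w + wdeg ((w, k) :: z))%N.
  by rewrite wdeg_cons addnA.
apply: lspan_trans => y [Ny|[w' [k' [z' [/eqP-> wz' ->]]]]]; first exact: IHm Ny.
apply: lspan_mem; apply/flattenP.
exists (rel_words v w (level v - level w + wdeg ((w, k) :: z))).
  by apply/mapP; exists (v, w) => //; rewrite mem_enum.
by apply/mapP; exists ((w, k') :: z') => //; rewrite addKn.
Qed.

Lemma size_rel_span_words n : size (rel_span_words n) =
  (\sum_(v : vposet G) \sum_(w : vposet G | (w < v)%O) nb_words_from w (n - (level v - level w)))%N.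
Proof.
rewrite pair_big_dep /= size_flatten /shape -map_comp sumnE big_map big_enum /=.
by apply: eq_bigr => p _; rewrite /= size_map.
Qed.

End Relations.

(** * From the free algebra to the free right module *)

Lemma path_vec_start (R : nzRingType) (f q : {poly R}) :
  0 * q - (f - 'X^0 * f) = 0.
Proof. by rewrite mul0r expr0 mul1r !subrr. Qed.

Lemma path_vec_step (R : nzRingType) (f g h y p q : {poly R}) (a : R) n :
  'X^1 * (y * q - (g - 'X^n * h)) - (f - 'X * g - a *: (p * q)) =
  ('X * y + a *: p) * q - (f - 'X^(n.+1) * h).
Proof.
rewrite expr1 exprS mulrDl -scalerAl !mulrBr -!mulrA.
by rewrite !opprB addrACA [_ - 'X * g + _]addrA subrK.
Qed.

Section FreeSide.
Context (F : fieldType) (G : layered_graph) (hmin : unique_minimal G).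
Local Notation A := (graphAlg F G).
Local Notation freeAlg := {malg F[{fmonom (edge G)}]}.
Local Notation pi := (@graphAlg_pi F G).
Local Notation vp := (@vpoly F G hmin).
Local Notation comp := (@graphAlg_comp F G).
Local Notation X := {ffun slot G -> A}.
Local Notation mon := (@word_monom F (edge G)).
Local Notation ract := (@right_action_ffun F A (slot G)).
Implicit Types (u v w : vposet G).

Definition slot_vec v k : X := [ffun i => revcoef (level v) (formal_poly A v i) k].

Definition edge_vec (e : edge G) : X := slot_vec (tail e) 1 - slot_vec (head e) 1.

(** In the algebra the edge [e] from [v] to [w] is [c_1(w) - c_1(v)], which
    explains the sign. *)
Definition word_vec (s : seq (edge G)) : X :=
  if s is e :: s' then - ffun_act (edge_vec e) (pi (mon s')) else 0.

Definition free_vec : freeAlg -> X := linear_ext word_vec.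
(** The ideal of relations is not given degree by degree; keeping only the
    words of one length selects its homogeneous parts. *)
Definition graded_vec n : freeAlg -> X :=
  linear_ext (fun s => if size s == n then word_vec s else 0).
HB.instance Definition _ := GRing.Linear.on free_vec.
HB.instance Definition _ n := GRing.Linear.on (graded_vec n).

Lemma free_vecB x y : free_vec (x - y) = free_vec x - free_vec y.
Proof. exact: linearB. Qed.

Lemma graded_vecD n x y : graded_vec n (x + y) = graded_vec n x + graded_vec n y.
Proof. exact: linearD. Qed.

Lemma graded_vecB n x y : graded_vec n (x - y) = graded_vec n x - graded_vec n y.
Proof. exact: linearB. Qed.

Lemma graded_vec0 n : graded_vec n 0 = 0.
Proof. exact: linear0. Qed.

Definition monoms_of_size n (x : freeAlg) := exists2 s, size s = n & x = mon s.

Lemma graded_vecE d n x : lspan (monoms_of_size d) x ->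
  graded_vec n x = if d == n then free_vec x else 0.
Proof.
apply: (@lspan_eq _ _ _ _ _ (fun x => if d == n then free_vec x else 0)).
- exact: linearP.
- by case: (d == n) => [|a y z]; [exact: linearP|rewrite scaler0 addr0].
- by move=> _ [s <- ->]; rewrite /graded_vec /free_vec !linear_ext_monom.
Qed.

Lemma pi_mul x y : pi (x * y) = pi x * pi y.
Proof. exact: rmorphM. Qed.

Lemma free_vec_gen e x : free_vec (mon [:: e] * x) = - ffun_act (edge_vec e) (pi x).
Proof.
apply: (@lspan_eq _ _ _ _ (fun x => free_vec (mon [:: e] * x))
  (fun x => - ffun_act (edge_vec e) (pi x)) _ _ _ _ (malg_span x)).
- by move=> a y z; rewrite mulrDr -freeAlg_scalerAr linearP.
- by move=> a y z; rewrite linearP (act_linear_r ract) opprD scalerN.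
- by move=> _ [s _ ->]; rewrite -word_monom_cat /free_vec linear_ext_monom.
Qed.

Lemma free_vec_mon d x s : (0 < d)%N -> lspan (monoms_of_size d) x ->
  free_vec (x * mon s) = ffun_act (free_vec x) (pi (mon s)).
Proof.
move=> d0; apply: (@lspan_eq _ _ _ _ (fun x => free_vec (x * mon s))
  (fun x => ffun_act (free_vec x) (pi (mon s)))).
- by move=> a y z; rewrite mulrDl -scalerAl linearP.
- by move=> a y z; rewrite linearP (act_linear_l ract).
move=> _ [[|e t] szt ->]; first by rewrite -szt in d0.
rewrite -word_monom_cat /free_vec !linear_ext_monom [word_vec _]/=.
by rewrite word_monom_cat pi_mul ffun_actNM.
Qed.

Lemma monoms_of_size_mul m n x y : lspan (monoms_of_size m) x -> lspan (monoms_of_size n) y ->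
  lspan (monoms_of_size (m + n)) (x * y).
Proof.
apply: lspan_mul (@freeAlg_scalerAr _ _) _ => _ _ [s <- ->] [s' <- ->].
by apply: lspan_mem; exists (s ++ s'); rewrite ?size_cat ?word_monom_cat.
Qed.

Lemma path_poly_monoms p j : (j <= size p)%N ->
  lspan (monoms_of_size (size p - j)) (path_poly F p)`_j.
Proof.
move=> jp; apply: lspan_mono (path_poly_homogeneous F p j) => _ [s <- ->].
by exists s; rewrite ?addnK.
Qed.

(** The image of the polynomial of a path, coefficient by coefficient. *)
Fixpoint path_vec (p : seq (edge G)) (i : slot G) : {poly A} :=
  if p is e :: p' then 'X * path_vec p' i + edge_vec e i *: pathP F p' else 0.

Lemma free_vec_path p j : free_vec (path_poly F p)`_j = ffun_coef (path_vec p) j.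
Proof.
elim: p j => [|e p IHp] j.
  rewrite /path_poly big_nil coef1; have -> : ffun_coef (path_vec [::]) j = 0.
    by apply/ffunP => i; rewrite !ffunE coef0.
  by case: j => [|j]; rewrite ?linear0 // -word_monom0 /free_vec linear_ext_monom.
rewrite /path_poly big_cons -/(path_poly F p) mulrBl coefB coefXM coefCM linearB.
have -> : gen F e = mon [:: e] by rewrite /gen /word_monom fmuE.
rewrite [X in _ - X]free_vec_gen opprK [RHS]ffun_coef_mulX_add -map_path_poly.
rewrite coef_map; congr (_ + _).
by case: j => [|j] /=; rewrite ?linear0 // IHp.
Qed.

Lemma dipath_or_nil_vpoly u p v : dipath_or_nil u p v -> vp u = pathP F p * vp v.
Proof.
case: p => [->|e p upv]; first by rewrite /pathP big_nil mul1r.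
exact: vpolyE.
Qed.

Local Notation rels := (@rel_space F G hmin (top_level G).+1).

Let rels_span := @rel_space_span F G hmin (top_level G).+1.

(** For an edge the division takes a single step, and the quotient is the
    image of the edge. *)
Lemma edge_rel_poly e i : rel_poly F hmin (tail e) (head e) i =
  formal_poly A (tail e) i - 'X * formal_poly A (head e) i - edge_vec e i *: vp (head e).
Proof.
have lev_e := level_tail e.
rewrite /rel_poly lev_e subSnn expr1.
rewrite (@rmodp_sub_lead _ _ _ (level (head e))) ?vpoly_monic ?size_vpoly //.
  congr (_ - _ *: _); rewrite coefB coefXM /edge_vec !ffunE /revcoef lev_e /= subSS subn0.
  by case: (nat_of_ord (level (head e))) => //= n; rewrite subn1.
have szt := size_formal_poly A (tail e) i; have szh := size_formal_poly A (head e) i.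
rewrite (leq_trans (size_polyD _ _)) // geq_max size_polyN -{1}lev_e szt /=.
have [->|f0] := eqVneq (formal_poly A (head e) i) 0; first by rewrite mulr0 size_poly0.
by rewrite -commr_polyX size_mulX.
Qed.

(** By induction along the path, [path_vec p] is the quotient of the division
    that defines the relation between its two ends. *)
Lemma path_vec_formal u p v : dipath_or_nil u p v ->
  homog rels (level u) (fun i => path_vec p i * vp v -
    (formal_poly A u i - 'X^(size p) * formal_poly A v i)).
Proof.
elim: p u => [|e p IHp] u.
  move=> ->; apply: (homog0 rels_span) => i.
  exact: path_vec_start.
move=> upv; have [-> wpv] := dipath_cons upv; have vpw := dipath_or_nil_vpoly wpv.
have lev_e := level_tail e.
have he_te : ((head e : vposet G) < (tail e : vposet G))%O by apply/asboolP; exists [:: e].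
have h1 := homogXn rels_span 1 (IHp _ wpv); rewrite add1n -lev_e in h1.
have h2 := rel_poly_homog F hmin he_te (ltn_ord (level (head e))).
apply: homog_ext (homogB rels_span h1 h2) => i.
by rewrite edge_rel_poly vpw; exact: path_vec_step.
Qed.

End FreeSide.

Lemma path_vec_difference (R : nzRingType) (y z q f : {poly R}) :
  (y * q - f) - (z * q - f) = (y - z) * q.
Proof. by rewrite opprB addrA subrK mulrBl. Qed.

Lemma path_vec_bottom (R : nzRingType) (y f : {poly R}) n :
  y * 1 - (f - 'X^n * 0) = y - f.
Proof. by rewrite mulr1 mulr0 subr0. Qed.

Lemma path_poly_top (F : fieldType) (G : layered_graph) (p : seq (edge G)) m :
  (size p <= m)%N -> (path_poly F p)`_m = (m == size p)%:R.
Proof.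
have szp : size (path_poly F p) = (size p).+1 by rewrite /path_poly size_prod_XsubC.
have /monicP : path_poly F p \is monic by apply: monic_prod_XsubC.
rewrite lead_coefE szp /= => top; rewrite leq_eqVlt => /orP[/eqP<-|lt_m].
  by rewrite eqxx.
by rewrite nth_default ?szp // gtn_eqF.
Qed.

Section Relators.
Context (F : fieldType) (G : layered_graph) (hmin : unique_minimal G).
Local Notation A := (graphAlg F G).
Local Notation freeAlg := {malg F[{fmonom (edge G)}]}.
Local Notation pi := (@graphAlg_pi F G).
Local Notation vp := (@vpoly F G hmin).
Local Notation comp := (@graphAlg_comp F G).
Local Notation X := {ffun slot G -> A}.
Local Notation mon := (@word_monom F (edge G)).
Local Notation ract := (@right_action_ffun F A (slot G)).
Local Notation rels := (@rel_space F G hmin (top_level G).+1).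
Let rels_span := @rel_space_span F G hmin (top_level G).+1.
Let rels_act := @rel_space_act F G hmin (top_level G).+1.
Implicit Types (u v w : vposet G).

(** Multiplied by the polynomial of the common end, the images of the two
    paths agree with the same expression modulo relations, and this monic
    polynomial can be cancelled. *)
Lemma path_vec_relator u v p q : dipath u p v -> dipath u q v ->
  homog rels (size p) (fun i => path_vec F p i - path_vec F q i).
Proof.
move=> upv uqv.
have h1 := path_vec_formal F hmin (dipath_dipath_or_nil upv).
have h2 := path_vec_formal F hmin (dipath_dipath_or_nil uqv).
have szpq : size p = size q.
  by apply: (@addIn (level v)); rewrite (dipath_size upv) (dipath_size uqv).
apply: (homog_cancel rels_span rels_act (vpoly_monic F hmin v) (size_vpoly F hmin v)
  (homog_vpoly F hmin v)).
rewrite (dipath_size upv); apply: homog_ext (homogB rels_span h1 h2) => i.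
by rewrite szpq; exact: path_vec_difference.
Qed.

Lemma relator_vec r : relator r -> r = 0 \/ exists2 d, (0 < d)%N &
  lspan (@monoms_of_size F G d) r /\ rels d (free_vec r).
Proof.
case=> [u [v [p [q [m [upv uqv szpq ->]]]]]].
have [pm|mp] := leqP (size p) m.
  by left; rewrite !path_poly_top -?szpq // subrr.
right; exists (size p - m)%N; first by rewrite subn_gt0.
split.
  apply: lspanB; first by apply: path_poly_monoms; apply: ltnW.
  by rewrite szpq; apply: path_poly_monoms; rewrite -szpq ltnW.
rewrite free_vecB !free_vec_path -ffun_coefB.
by have [+ _] := path_vec_relator upv uqv m; apply; apply: ltnW.
Qed.

Lemma pi_relator r : relator r -> pi r = 0.
Proof.
move=> rr; rewrite -(linear0 (@graphAlg_pi F G)); apply/graphAlg_piP.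
by rewrite subr0; apply/rel_idealP/IdealGen.
Qed.

(** With an edge in front, the relator is evaluated in the algebra, where it
    vanishes; with nothing in front, the word behind it only acts on the
    right. *)
Lemma relator_word_vec r s s' n : relator r ->
  rels n (graded_vec n (mon s * r * mon s')).
Proof.
move=> rr; have [->|[d d0 [rd rels_r]]] := relator_vec rr.
  by rewrite mulr0 mul0r graded_vec0; apply/rels_span/lspan0.
have mons (t : seq (edge G)) : lspan (@monoms_of_size F G (size t)) (mon t).
  by apply: lspan_mem; exists t.
rewrite (graded_vecE n (monoms_of_size_mul (monoms_of_size_mul (mons s) rd) (mons s'))).
case: eqP => [<-|_]; last exact/rels_span/lspan0.
case: s => [|e s].
  rewrite word_monom0 mul1r (free_vec_mon _ d0 rd) add0n; apply: rels_act rels_r _.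
  by apply/graphAlg_compP/lspan_mem; exists s'.
rewrite -cat1s word_monom_cat -!mulrA free_vec_gen !pi_mul (pi_relator rr).
by rewrite mul0r mulr0 (act0 ract) oppr0; apply/rels_span/lspan0.
Qed.

Lemma ideal_word_vec x : ideal_gen (@relator F G) x ->
  forall a b n, rels n (graded_vec n (a * x * b)).
Proof.
elim=> {x} [r rr||x y _ IHx _ IHy|c x _ IHx|c x _ IHx] a b n.
- have lin_a : linear (fun a => graded_vec n (a * r * b)).
    by move=> k y z; rewrite !mulrDl -!scalerAl linearP.
  apply/rels_span; apply: (lspan_map lin_a) (malg_span a) => _ [s _ ->].
  have lin_b : linear (fun b => graded_vec n (mon s * r * b)).
    by move=> k y z; rewrite mulrDr -freeAlg_scalerAr linearP.
  apply: (lspan_map lin_b) (malg_span b) => _ [s' _ ->].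
  by apply: lspan_mem; apply: relator_word_vec.
- by rewrite mulr0 mul0r graded_vec0; apply/rels_span/lspan0.
- rewrite mulrDr mulrDl graded_vecD.
  by apply/rels_span/lspanD; apply: lspan_mem; [apply: IHx|apply: IHy].
- by rewrite mulrA; apply: IHx.
- by rewrite -[_ * _ * b]mulrA -[x * c * b]mulrA mulrA; apply: IHx.
Qed.

Lemma graded_vec_ideal x y n : pi x = pi y -> rels n (graded_vec n (x - y)).
Proof.
move/graphAlg_piP/rel_idealP/ideal_word_vec => /(_ 1 1 n).
by rewrite mul1r mulr1.
Qed.

Lemma free_vec_mul d x y : (0 < d)%N -> lspan (@monoms_of_size F G d) x ->
  free_vec (x * y) = ffun_act (free_vec x) (pi y).
Proof.
move=> d0 dx; apply: (@lspan_eq _ _ _ _ (fun y => free_vec (x * y))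
  (fun y => ffun_act (free_vec x) (pi y)) _ _ _ _ (malg_span y)).
- by move=> k z t; rewrite mulrDr -freeAlg_scalerAr linearP.
- by move=> k z t; rewrite linearP (act_linear_r ract).
- by move=> _ [s _ ->]; apply: free_vec_mon dx.
Qed.

(** For [a = 1] the lift is a coefficient of the polynomial of a path from [v]
    to the bottom vertex, whose own polynomial is [1]. *)
Lemma slot_vec_lift v k j a : letter_ok (v, k) -> comp j a ->
  exists2 y, comp (k + j) (pi y) &
    rels (k + j) (graded_vec (k + j)%N y - ffun_act (slot_vec F v k) a).
Proof.
case/andP=> /= k0 kv ja; have v0 : level v != 0%N :> nat by lia.
have [b b0 vb] := dipath_descent hmin v0.
have [x xj aE] := ja.
have jx : lspan (@monoms_of_size F G j) x.
  by apply: lspan_mono (malg_span x) => _ [s /xj sj ->]; exists s.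
set p := descent hmin v in vb.
have szp : size p = level v by rewrite size_descent.
pose t := (path_poly F p)`_(level v - k).
have kt : lspan (@monoms_of_size F G k) t.
  by rewrite -{1}(subKn kv) -{1}szp; apply: path_poly_monoms; rewrite szp leq_subr.
exists (t * x).
  rewrite pi_mul -aE; apply: graphAlg_compM => //.
  apply/graphAlg_compP; rewrite -[graphAlg_pi t]/(pi t).
  by apply: lspan_linear kt => _ [s sk ->]; apply: lspan_mem; exists s.
rewrite (graded_vecE _ (monoms_of_size_mul kt jx)) eqxx (free_vec_mul _ k0 kt) -aE.
rewrite -(actBl ract); apply: rels_act ja; rewrite free_vec_path.
have vpb : vp b = 1 by apply: vpoly_bottom.
have fb i : formal_poly A b i = 0 by apply: formal_poly_bottom.
have hom : homog rels (level v) (fun i => path_vec F p i - formal_poly A v i).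
  apply: homog_ext (path_vec_formal F hmin (dipath_dipath_or_nil vb)) => i.
  by rewrite vpb fb; exact: path_vec_bottom.
have [+ _] := hom (level v - k)%N; move/(_ (leq_subr _ _)).
rewrite subKn // ffun_coefB; set e := ffun_coef (formal_poly A v) _.
suff -> : slot_vec F v k = e by [].
by apply/ffunP => i; rewrite !ffunE /revcoef kv.
Qed.

Lemma slot_vecE v k i : letter_ok (v, k) ->
  slot_vec F v k i = ((i.1 == v) && (i.2 == k :> nat))%:R.
Proof.
by move=> ok_vk; rewrite ffunE; apply: revcoef_formal_poly.
Qed.

End Relators.

(** * The Hilbert series counts normal words *)

Lemma independent_tagged (F : fieldType) (A : algType F) (I : finType)
    (m : I -> nat) (B : forall i, 'I_(m i) -> A) (e : I -> {ffun I -> A}) :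
  (forall i (x : 'I_(m i)) i', e i i' = (i' == i)%:R) ->
  (forall i, independent (B i)) ->
  independent (fun j : {i : I & 'I_(m i)} => ffun_act (e (tag j)) (B (tag j) (tagged j))).
Proof.
move=> eE indB c sum0 [i x].
apply: (indB i (fun x => c (Tagged (fun i => 'I_(m i)) x)) _ x).
have /ffunP/(_ i) := sum0; rewrite sum_ffunE !ffunE => sum0i; rewrite -[RHS]sum0i.
rewrite (eq_bigr (fun j : {i : I & 'I_(m i)} =>
  (fun i' (x' : 'I_(m i')) => (i == i')%:R *: (c (Tagged _ x') *: B i' x')) (tag j) (tagged j))).
  rewrite -(@sig_big_dep _ _ _ _ _ predT (fun=> predT) (fun i' (x' : 'I_(m i')) =>
    (i == i')%:R *: (c (Tagged _ x') *: B i' x'))) /=.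
  rewrite (bigD1 i) //= eqxx [X in _ = _ + X]big1 ?addr0.
    by apply: eq_bigr => y _; rewrite scale1r.
  by move=> i' /negPf ii'; rewrite big1 // => y _; rewrite eq_sym ii' scale0r.
move=> [i' x'] _ /=; rewrite !ffunE (eE i' x') scalerA mulrC -scalerA; congr (_ *: _).
by case: (i == i'); rewrite ?mul1r ?scale1r // mul0r scale0r.
Qed.

Section HilbertCoef.
Context (F : fieldType) (G : layered_graph) (hmin : unique_minimal G).
Local Notation A := (graphAlg F G).
Local Notation freeAlg := {malg F[{fmonom (edge G)}]}.
Local Notation pi := (@graphAlg_pi F G).
Local Notation comp := (@graphAlg_comp F G).
Local Notation X := {ffun slot G -> A}.
Local Notation h := (hilbert_coef F G).
Local Notation ract := (@right_action_ffun F A (slot G)).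
Local Notation rels := (@rel_space F G hmin (top_level G).+1).

Lemma hilbert_dim n : has_dim (@graphAlg_comp F G n) (h n) /\ (h n <= nb_words G n)%N.
Proof.
have [||m dim_m le_m] := @has_dim_exists F A (comp n)
    [seq word_val F hmin z | z <- normal_words G n].
- move=> _ /mapP[z /normal_wordsP[_ <-] ->]; exact: word_val_comp.
- exact: graphAlg_normal_span.
by rewrite /hilbert_coef (subdimE dim_m); rewrite size_map in le_m.
Qed.

(** The contribution of the slot [(v, k)] to the dimension of the free right
    module in degree [n]. *)
Definition slot_dim n (i : slot G) : nat :=
  if (0 < i.2 <= minn n (level i.1))%N then h (n - i.2) else 0%N.

Lemma slot_basis_exists n i : exists B : 'I_(slot_dim n i) -> A, independent B /\
  forall x, [/\ comp (n - i.2) (B x), letter_ok (i.1, nat_of_ord i.2) & (i.2 <= n)%N].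
Proof.
rewrite /slot_dim; case: ifP => [/andP[i0]|_].
  rewrite leq_min => /andP[le_in iv]; have [[B [BA indB _]] _] := hilbert_dim (n - i.2).
  by exists B; split=> // x; split; rewrite // /letter_ok /= i0.
exists (fun=> 0); split=> [c _ []//|[]//].
Qed.

Definition slot_basis n i := projT1 (cid (slot_basis_exists n i)).

Definition slot_family n (j : {i : slot G & 'I_(slot_dim n i)}) : X :=
  ffun_act (slot_vec F (tag j).1 (tag j).2) (slot_basis (tagged j)).

Lemma slot_family_independent n : independent (@slot_family n).
Proof.
apply: (@independent_tagged F A (slot G) (slot_dim n) (@slot_basis n)
  (fun i => slot_vec F i.1 i.2)) => [i x i'|i].
  have [_ /(_ x)[_ ok_i _]] := projT2 (cid (slot_basis_exists n i)).
  by rewrite slot_vecE // -[i' == i]/((i'.1 == i.1) && (i'.2 == i.2)) val_eqE.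
by have [] := projT2 (cid (slot_basis_exists n i)).
Qed.

(** Up to relations, the elements of degree [n] of the free right module come
    from the free algebra modulo its ideal, that is, from a basis of the
    algebra in degree [n]. *)
Lemma hilbert_coef_lower n :
  (\sum_(i : slot G) slot_dim n i <= h n + size (rel_span_words F hmin n))%N.
Proof.
have [[B [BA _ B_span]] _] := hilbert_dim n.
have /choice[y yE] : forall l, exists y, B l = pi y.
  by move=> l; have [y _ ->] := BA l; exists y.
pose s := [seq graded_vec n (y l) | l <- enum 'I_(h n)] ++ rel_span_words F hmin n.
have -> : (h n + size (rel_span_words F hmin n) = size s)%N.
  by rewrite size_cat size_map size_enum_ord.
have -> : (\sum_(i : slot G) slot_dim n i = #|{: {i : slot G & 'I_(slot_dim n i)}}|)%N.
  rewrite card_tagged sumnE big_map big_enum; apply: eq_bigr => i _.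
  by rewrite card_ord.
have rels_s x : rels n x -> lspan (fun z => z \in s) x.
  move/rel_space_words; apply: lspan_mono => z zs.
  by rewrite mem_cat zs orbT.
apply: independent_leq_size (@slot_family_independent n) _ => -[i x].
have [_ /(_ x)[Bx ok_i le_in]] := projT2 (cid (slot_basis_exists n i)).
have [z] := slot_vec_lift hmin ok_i Bx; rewrite subnKC // => zn rels_z.
have [c zE] := B_span _ zn.
have zE' : pi z = pi (\sum_l c l *: y l).
  by rewrite zE linear_sum; apply: eq_bigr => l _; rewrite linearZ yE.
have := graded_vec_ideal hmin n zE'; rewrite graded_vecB.
set w := \sum_l _ => rels_w; rewrite /slot_family /=.
apply: (lspan_subr (rels_s _ rels_z)); apply: (lspan_subl (rels_s _ rels_w)).
apply: (lspan_linear (P := fun v => exists l, v = y l)) => [_ [l ->]|].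
  apply: lspan_mem; rewrite mem_cat.
  by apply/orP; left; apply: map_f; rewrite mem_enum.
by apply: lspan_sum => l _; apply/lspanZ/lspan_mem; exists l.
Qed.

Lemma sum_slot_dim n : (\sum_(i : slot G) slot_dim n i =
  \sum_(v : vposet G) \sum_(1 <= k < (minn n (level v)).+1) h (n - k))%N.
Proof.
rewrite -(pair_bigA _ (fun v (k : 'I_(top_level G).+1) => slot_dim n (v, k))) /=.
apply: eq_bigr => v _; rewrite /slot_dim /= -big_mkcond /=.
set m := minn n (level v).
have le_m : (m < (top_level G).+1)%N by rewrite ltnS geq_min orbC -ltnS ltn_ord.
rewrite -(big_mkord (fun k => 0 < k <= m)%N (fun k => h (n - k))).
rewrite [RHS](big_nat_widen _ _ (top_level G).+1) // [LHS]big_ltn_cond //=.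
by apply: congr_big_nat => // k /andP[-> _]; rewrite ltnS.
Qed.

End HilbertCoef.

(** Normal words span, and by induction on the degree the lower bound leaves no
    room for a smaller dimension. *)
Theorem hilbert_coef_nb_words (F : fieldType) (G : layered_graph)
    (hmin : unique_minimal G) n :
  hilbert_coef F G n = nb_words G n.
Proof.
elim/ltn_ind: n => n IHn; apply/eqP; rewrite eqn_leq (hilbert_dim F hmin n).2 /=.
have [n0|n0] := posnP n.
  rewrite n0 nb_words0; have [[B [BA indB spB]] _] := hilbert_dim F hmin 0.
  rewrite lt0n; apply/eqP => h0; have [c] := spB _ (graphAlg_comp1 F G).
  rewrite big1 => [/eqP|i]; first by rewrite oner_eq0.
  by exfalso; case: i => i; rewrite h0.
rewrite -(leq_add2r (size (rel_span_words F hmin n))).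
apply: leq_trans (hilbert_coef_lower F hmin n); rewrite sum_slot_dim size_rel_span_words.
rewrite nb_wordsE // -big_split /=; apply: leq_sum => v _.
rewrite nb_words_from_rec; apply/eq_leq/eq_big_nat => k /andP[k0 _].
by rewrite IHn // ltn_subrL k0 n0.
Qed.

(** * The Euler-Poincare formula *)

Section EulerCharacteristic.
Context (F : fieldType) (d : Order.disp_t) (P : finPOrderType d).
Local Notation chain := (chain P).

(** Passing from [n] to [n.+1] adds a row and a column with opposite terms. *)
Lemma sum_alternating_pairs (V : zmodType) n (T : nat -> nat -> V) :
  (forall l m, (l <= m < n)%N -> T m.+1 l = - T l m) ->
  \sum_(l < n.+1) \sum_(m < n) T l m = 0.
Proof.
elim: n => [|n IHn] TE; first by rewrite big1 // => l _; rewrite big_ord0.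
rewrite big_ord_recr /=; under eq_bigr => l _ do rewrite big_ord_recr /=.
rewrite big_split /= IHn => [|l m /andP[lm mn]]; last by rewrite TE // lm ltnW.
rewrite add0r -big_split big1 //= => l _.
by rewrite TE ?addrN // -ltnS ltn_ord ltnSn.
Qed.

Lemma face_face s (c : chain s.+2) l m : (l <= m < s.+1)%N ->
  face (face c (inord m.+1)) (inord l) = face (face c (inord l)) (inord m).
Proof.
case/andP=> lm ms; apply/val_inj/eq_from_tnth => j /=; rewrite !tnth_mktuple.
congr (tnth _ _); apply/val_inj => /=.
by rewrite !inordK /bump; lia.
Qed.

Lemma bdry_chainb s (c : chain s.+1) :
  bdry_fun (chainb F c) = \sum_(l < s.+1) (-1) ^+ l *: chainb F (face c l).
Proof.
rewrite /bdry_fun (bigD1 c) //= [chainb F c c]ffunE eqxx scale1r.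
rewrite [X in _ + X]big1 ?addr0 // => c' /negPf cc'.
by rewrite [chainb F c c']ffunE cc' scale0r.
Qed.

Lemma bdry_bdry s (x : chainsp F P s.+2) : bdry_fun (bdry_fun x) = 0.
Proof.
rewrite [bdry_fun x]/bdry_fun linear_sum big1 // => c _.
suff bb0 : bdry_fun (\sum_(l < s.+2) (-1) ^+ l *: chainb F (face c l)) = 0.
  by rewrite linearZ -[RHS](scaler0 _ (x c)) -bb0.
pose T l m := (-1) ^+ l *: ((-1) ^+ m *: chainb F (face (face c (inord l)) (inord m))).
rewrite linear_sum -[RHS](@sum_alternating_pairs _ s.+1 T) => [|l m lm].
  apply: eq_bigr => l _.
  transitivity ((-1) ^+ l *: bdry_fun (chainb F (face c l))); first exact: linearZ.
  rewrite bdry_chainb scaler_sumr.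
  by apply: eq_bigr => m _; rewrite /T !inord_val.
rewrite /T face_face // !scalerA -!exprD addSn exprS mulN1r scaleNr.
by rewrite addnC.
Qed.

Lemma cobdry_cobdry s (f : cochainsp F P s) : cobdry F P s.+1 (cobdry F P s f) = 0.
Proof.
apply/lfunP => x; rewrite !lfunE /= /cobdry_fun !comp_lfunE !lfunE /=.
by rewrite bdry_bdry linear0.
Qed.

Lemma dim_cochainsp s : \dim {: cochainsp F P s} = #|{: chain s}|.
Proof.
rewrite dimvf; transitivity (#|{: chain s}| * 1 * 1)%N; first by [].
by rewrite !muln1.
Qed.

Lemma coboundaries_sub_cocycles s :
  (coboundaries F P s <= cocycles F P s)%VS.
Proof.
case: s => [|s]; first exact: sub0v.
apply/subvP => _ /memv_imgP[f _ ->]; rewrite memv_ker cobdry_cobdry.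
by [].
Qed.

Lemma dim_cocycles s :
  (\dim (cocycles F P s) + \dim (coboundaries F P s.+1))%N = #|{: chain s}|.
Proof. by rewrite -dim_cochainsp -(limg_ker_dim (cobdry F P s) fullv) capfv. Qed.

(** Euler-Poincare: the coboundaries cancel in pairs. *)
Theorem euler_poincare n : #|{: chain n}| = 0%N ->
  \sum_(0 <= s < n) (-1) ^+ s * (dim_cohom F P s)%:Z =
  \sum_(0 <= s < n) (-1) ^+ s * (#|{: chain s}|)%:Z.
Proof.
move=> chain_n0.
pose b s := (\dim (coboundaries F P s))%:Z.
have bn0 : b n = 0.
  have := dimvS (subvf (coboundaries F P n)).
  by rewrite dim_cochainsp chain_n0 leqn0 /b => /eqP->.
have b0 : b 0%N = 0 by rewrite /b /= dimv0.
have E s : (dim_cohom F P s)%:Z = (#|{: chain s}|)%:Z - b s.+1 - b s.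
  rewrite -dim_cocycles PoszD /b addrK /dim_cohom.
  by rewrite -subzn // dimvS // coboundaries_sub_cocycles.
suff H m : \sum_(0 <= s < m) (-1) ^+ s * (dim_cohom F P s)%:Z =
    \sum_(0 <= s < m) (-1) ^+ s * (#|{: chain s}|)%:Z + (-1) ^+ m * b m.
  by rewrite H bn0 mulr0 addr0.
elim: m => [|m IHm]; first by rewrite !big_geq // b0 mulr0 addr0.
rewrite !big_nat_recr //= IHm E !mulrBr exprS mulN1r mulNr.
rewrite -!addrA; congr (_ + _); rewrite addrC -!addrA.
by rewrite addNr addr0.
Qed.

End EulerCharacteristic.

(** * Chains in the posets Gamma_{a,i} *)

Section BelowChains.
Context (G : layered_graph).
Implicit Types (a u v w : vposet G).
Local Open Scope nat_scope.

Definition inside a i w := (w < a)%O && (level a - level w <= i - 1).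

Lemma below_dipath a i (x y : vposet (below a i)) p :
  dipath x p y -> @dipath G (val x) (map val p) (val y).
Proof.
case: p => [|e p] //= [<- pp <-]; split=> //.
  elim: p e pp => [|f p IHp] e //= /andP[/eqP hf pp].
  by rewrite IHp // andbT; apply/eqP; exact: (congr1 val hf).
by rewrite last_map.
Qed.

(** A path between two vertices of the induced subgraph never leaves it. *)
Lemma dipath_below a i p (x y : vposet (below a i)) :
  @dipath G (val x) p (val y) -> exists q, dipath x q y.
Proof.
elim: p x => // e p IHp x xpy; have [te wpy] := dipath_cons xpy.
have lt_wx : ((head e : vposet G) < val x)%O by rewrite te; apply/asboolP; exists [:: e].
have inW (z : vposet (below a i)) : inside a i (val z) by have := valP z; rewrite inE.
have Wx := inW x; have /andP[ya yi] := inW y; have /andP[xa xi] := Wx.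
have Ww : inside a i (head e).
  rewrite /inside (lt_trans lt_wx xa) /=; case: p wpy {IHp xpy} => [->//|f p wpy].
  apply: leq_trans yi; apply: leq_sub2l; apply: ltnW; exact: dipath_level wpy.
have Ww' : (head e : vposet G) \in [set w : vposet G | inside a i w] by rewrite in_set.
have We : (tail e \in [set w : vposet G | inside a i w]) &&
          (head e \in [set w : vposet G | inside a i w]).
  apply/andP; split; last exact: Ww'.
  by rewrite -te; exact: valP x.
pose ez : edge (below a i) := Sub e We.
have tz : tail ez = x :> vposet (below a i) by apply/val_inj.
case: p wpy IHp {xpy} => [wy _|f p wpy /(_ (head ez))[]//].
  by exists [:: ez]; split=> //; apply/val_inj.
move=> q hq; exists ([:: ez] ++ q); apply: dipath_cat hq; by [].
Qed.

Lemma below_lt a i (x y : vposet (below a i)) :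
  (x < y)%O = ((val x : vposet G) < val y)%O.
Proof.
apply/asboolP/asboolP => [[p /below_dipath yx]|[p /dipath_below//]].
by exists (map val p).
Qed.

Definition nb_chains a i s :=
  #|[set t : s.-tuple (vposet G) | sorted <%O t && all (inside a i) t]|.

Lemma card_chain_below a i s : #|{: chain (vposet (below a i)) s}| = nb_chains a i s.
Proof.
pose f (c : chain (vposet (below a i)) s) : s.-tuple (vposet G) :=
  [tuple of map val (val c)].
have f_inj : injective f.
  move=> c1 c2 /(congr1 val) /= eq_f; apply/val_inj/val_inj.
  exact: (inj_map val_inj) eq_f.
rewrite -(card_imset predT f_inj); apply: eq_card => t; rewrite inE.
apply/imsetP/andP => [[c _ ->]|[t_lt t_in]].
  split; last by apply/allP => _ /mapP[z _ ->]; have := valP z; rewrite inE.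
  rewrite sorted_map; have := valP c; congr (is_true _); apply: eq_sorted => x y.
  exact: below_lt.
have t_inW w : w \in t -> w \in [set w : vposet G | inside a i w].
  by rewrite inE => /(allP t_in).
pose z : s.-tuple (vposet (below a i)) :=
  [tuple (Sub (tnth t j) (t_inW _ (mem_tnth j t)) : vposet (below a i)) | j < s].
have zt : map val z = t.
  apply: (congr1 val (_ : [tuple of map val z] = t)); apply: eq_from_tnth => j.
  by rewrite tnth_map tnth_mktuple.
have z_lt : sorted (fun x y => x < y)%O z.
  move: t_lt; rewrite -zt sorted_map; congr (is_true _); apply: eq_sorted => x y.
  exact/esym/below_lt.
by exists (Sub z z_lt) => //; apply/val_inj; rewrite /= zt.
Qed.

Lemma nb_chains0 a i : nb_chains a i 0 = 1.
Proof.
rewrite /nb_chains -[RHS](card_tuple 0 (vposet G)) ?expn0.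
by apply: eq_card => t; rewrite inE tuple0.
Qed.

(** A nonempty chain is a smaller chain below its largest element. *)
Lemma nb_chainsS a i s : 0 < i ->
  nb_chains a i s.+1 =
    \sum_(w | inside a i w) nb_chains w (i - (level a - level w)) s.
Proof.
move=> i0; rewrite /nb_chains -sum1_card.
rewrite (partition_big (fun t : s.+1.-tuple (vposet G) => last (thead t) t) (inside a i)) /=.
  apply: eq_bigr => w aw; rewrite sum1_card.
  have rc (t : s.-tuple (vposet G)) : size (rcons t w) == s.+1 by rewrite size_rcons size_tuple.
  pose f (t : s.-tuple (vposet G)) : s.+1.-tuple (vposet G) := Tuple (rc t).
  have f_inj : injective f.
    by move=> t1 t2 /(congr1 val) /= /rcons_inj[] /val_inj.
  rewrite -(card_imset _ f_inj); apply: eq_card => t; rewrite unfold_in /= inE.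
  have insideE u : (u < w)%O -> inside a i u = inside w (i - (level a - level w)) u.
    move=> uw; have /andP[wa wi] := aw; have lt1 := lt_level wa; have lt2 := lt_level uw.
    rewrite /inside uw (lt_trans uw wa) /=; lia.
  have rcE (t' : s.-tuple (vposet G)) : sorted <%O (rcons t' w) && all (inside a i) (rcons t' w)
      = sorted <%O t' && all (inside w (i - (level a - level w))) t'.
    rewrite !sorted_pairwise ?pairwise_rcons ?all_rcons ?aw /=; try exact: lt_trans.
    rewrite andbAC; case: pairwise; rewrite ?andbF //= !andbT.
    rewrite -all_predI; apply: eq_all => u /=.
    have [uw|] := boolP (u < w)%O; first by rewrite insideE.
    by rewrite /inside => /negPf->.
  apply/idP/imsetP => [|[t' + ->]].
    case/andP=> t_ok /eqP lt.
    have szb : size (belast (thead t) (behead t)) == s.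
      by rewrite size_belast size_behead size_tuple.
    have tE : t = f (Tuple szb).
      apply/val_inj => /=; rewrite -lt; case/tupleP: t {t_ok lt szb} => x t /=.
      by rewrite theadE -lastI.
    exists (Tuple szb) => //; rewrite inE -rcE.
    by move: t_ok; rewrite {1 2}tE.
  by rewrite inE -rcE /= => ->; rewrite last_rcons eqxx.
move=> t; rewrite inE => /andP[_ /allP]; apply.
by case/tupleP: t => x t; rewrite theadE /= mem_last.
Qed.

Lemma nb_chains_big a i s : 0 < i <= s -> nb_chains a i s = 0.
Proof.
elim: s a i => [|s IHs] a i /andP[i0 si]; first by lia.
rewrite nb_chainsS // big1 // => w /andP[wa wi]; apply: IHs.
by have := lt_level wa; lia.
Qed.

End BelowChains.

Section Chi.
Context (G : layered_graph).
Implicit Types (a v w : vposet G).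

(** Up to sign, the reduced Euler characteristic of Gamma_{a,i}. *)
Definition chi a i : int := \sum_(0 <= s < i) (-1) ^+ s * (nb_chains a i s)%:Z.

Lemma chi_cohom (F : fieldType) a i : (0 < i)%N ->
  chi a i = \sum_(0 <= s < i) (-1) ^+ s * (dim_cohom F (vposet (below a i)) s)%:Z.
Proof.
move=> i0; rewrite euler_poincare; last by rewrite card_chain_below nb_chains_big // i0 /=.
by apply: eq_bigr => s _; rewrite card_chain_below.
Qed.

(** The terms of index [s >= i - (level a - level w)] vanish, a chain having at
    most one element in each level. *)
Lemma chi_rec a i : (0 < i)%N ->
  chi a i = 1 - \sum_(w | inside a i w) chi w (i - (level a - level w)).
Proof.
case: i => // i _; rewrite /chi big_nat_recl //= nb_chains0 expr0 mul1r; congr (_ + _).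
under eq_bigr => s _ do rewrite nb_chainsS // -natz natr_sum mulr_sumr.
rewrite exchange_big -sumrN; apply: eq_bigr => w /andP[wa wi] /=.
have lt_wa := lt_level wa; set j := (i.+1 - _)%N.
have ji : (0 < j <= i)%N by rewrite /j; lia.
rewrite [in LHS](big_cat_nat _ (n := j)) //=; last by case/andP: ji.
rewrite [X in _ + X]big_nat [X in _ + X]big1 ?addr0 => [|s /andP[js _]]; last first.
  by rewrite nb_chains_big ?mulr0 // js; case/andP: ji => ->.
by rewrite -sumrN; apply: eq_bigr => s _; rewrite exprS mulN1r mulNr natz.
Qed.

End Chi.

(** * Inversion of the Hilbert series *)

Section Inversion.
Context (G : layered_graph).
Implicit Types (a u v w : vposet G).

Definition shifted_nb_words n i : int := if (i <= n)%N then (nb_words G (n - i))%:Z else 0.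

Lemma sum_shifted_nb_words n m :
  (\sum_(1 <= k < (minn n m).+1) nb_words G (n - k))%:Z =
  \sum_(1 <= i < m.+1) shifted_nb_words n i.
Proof.
rewrite -natz natr_sum (big_nat_widen _ _ m.+1) ?ltnS ?geq_minr //.
rewrite big_mkcond; apply: eq_big_nat => i /andP[_ im].
have -> : (i < (minn n m).+1)%N = (i <= n)%N.
  by rewrite ltnS leq_min; move: im; rewrite ltnS => ->; rewrite andbT.
by rewrite /shifted_nb_words natz.
Qed.

(** The recursions for [nb_words_from] and [chi] have the same shape; one
    follows the other by induction on the level. *)
Lemma nb_words_from_chi v n :
  (nb_words_from v n)%:Z =
    \sum_(1 <= i < (level v).+1) chi v i * shifted_nb_words n i.
Proof.
have [m] := ubnP (level v); elim: m v n => // m IHm v n lt_m.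
have /(congr1 Posz) := nb_words_from_rec v n.
rewrite PoszD sum_shifted_nb_words => /(canRL (addrK _)) ->.
have -> : (\sum_(u | (u < v)%O) nb_words_from u (n - (level v - level u)))%:Z =
    \sum_(1 <= i < (level v).+1)
      (\sum_(u | inside v i u) chi u (i - (level v - level u))) * shifted_nb_words n i.
  rewrite -natz natr_sum.
  under [RHS]eq_bigr => i _ do rewrite mulr_suml big_mkcond.
  rewrite exchange_big [LHS]big_mkcond; apply: eq_bigr => u _ /=.
  have [uv|nuv] := boolP (u < v)%O; last first.
    by rewrite big1 // => i _; rewrite /inside (negPf nuv).
  have lt_uv := lt_level uv; rewrite natz IHm; last by move: lt_uv lt_m; clear; lia.
  set K := (level v - level u)%N.
  have levE : (level v = K + level u :> nat)%N by rewrite /K subnK // ltnW.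
  rewrite [RHS](big_cat_nat _ (n := K.+1)) //=; last by rewrite ltnS levE leq_addr.
  rewrite [X in X + _]big_nat [X in X + _]big1 ?add0r => [|i /andP[i0 iK]]; last first.
    by rewrite /inside uv /= -/K; case: ifP => //; move: i0 iK; clear; lia.
  rewrite -[K.+1]add1n big_addn (_ : ((level v).+1 - K = (level u).+1)%N); last first.
    by rewrite levE -addnS addKn.
  apply: eq_big_nat => i /andP[i0 iu]; rewrite /inside uv /= -/K.
  rewrite addnK ifT; last by move: i0; clear; lia.
  congr (_ * _); rewrite /shifted_nb_words.
  have [Kn|nK] := leqP K n.
    by rewrite leq_subRL // [(i + K)%N]addnC subnDA.
  rewrite !ifF //; move: nK i0; clear; lia.
rewrite -sumrB; apply: eq_big_nat => i /andP[i0 _].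
by rewrite chi_rec // mulrBl mul1r.
Qed.

End Inversion.

Section Coefficients.
Context (F : fieldType) (G : layered_graph).

Lemma inverse_series_coef n :
  (1 - \sum_(a : vposet G) \sum_(1 <= i < (level a).+1) \sum_(0 <= s < i)
       ((-1) ^+ s * (dim_cohom F (vposet (below a i)) s)%:Z) *: 'X^i : {poly int})`_n =
  if n is 0%N then 1 else - \sum_(a : vposet G | (n <= level a)%N) chi a n.
Proof.
rewrite coefB coef1 coef_sum.
have -> : \sum_(a : vposet G) (\sum_(1 <= i < (level a).+1) \sum_(0 <= s < i)
    ((-1) ^+ s * (dim_cohom F (vposet (below a i)) s)%:Z) *: 'X^i : {poly int})`_n =
    \sum_(a : vposet G | (0 < n <= level a)%N) chi a n.
  rewrite [RHS]big_mkcond; apply: eq_bigr => a _.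
  have -> : \sum_(1 <= i < (level a).+1) \sum_(0 <= s < i)
      ((-1) ^+ s * (dim_cohom F (vposet (below a i)) s)%:Z) *: 'X^i =
      \sum_(1 <= i < (level a).+1) chi a i *: ('X^i : {poly int}).
    apply: eq_big_nat => i /andP[i0 _].
    by rewrite -scaler_suml (chi_cohom F).
  rewrite coef_sum; case: ifP => [n_in|n_out].
    rewrite (bigD1_seq n) ?iota_uniq ?mem_index_iota //= coefZ coefXn eqxx mulr1.
    by rewrite big1 ?addr0 // => i /negPf ni; rewrite coefZ coefXn eq_sym ni mulr0.
  rewrite big_nat big1 // => i i_in; rewrite coefZ coefXn; case: eqP => [ni|]; rewrite ?mulr0 //.
  by move: n_out; rewrite ni -(ltnS i) i_in.
by case: n => [|n]; rewrite ?big_pred0_eq ?subr0 ?sub0r.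
Qed.

End Coefficients.

Theorem theorem4p1p1 (F : fieldType) (G : layered_graph)
    (hunif : uniform G) (hmin : unique_minimal G) :
  series_inverse
    (fun n => (hilbert_coef F G n)%:Z)
    (fun n =>
       (1 - \sum_(a : vposet G) \sum_(1 <= i < (level a).+1) \sum_(0 <= s < i)
              ((-1) ^+ s * (dim_cohom F (vposet (below a i)) s)%:Z) *: 'X^i
        : {poly int})`_n).
Proof.
move=> n; rewrite /series_mul.
under eq_bigr => k _ do rewrite (hilbert_coef_nb_words F hmin) inverse_series_coef.
rewrite (reindex_inj rev_ord_inj) /=.
pose g i := if i is 0%N then 1 else - \sum_(a : vposet G | (i <= level a)%N) chi a i.
rewrite (eq_bigr (fun i : 'I_n.+1 => (nb_words G (n - i))%:Z * g i)) => [|i _]; last first.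
  by rewrite subSS subKn // -ltnS.
rewrite -(big_mkord xpredT (fun i => (nb_words G (n - i))%:Z * g i)) big_ltn //= subn0 mulr1.
have [->|n0] := posnP n; first by rewrite big_geq // addr0.
rewrite nb_wordsE // -natz natr_sum.
under eq_bigr => v _ do rewrite natz nb_words_from_chi.
have {g}-> : \sum_(1 <= i < n.+1) (nb_words G (n - i))%:Z * g i =
    - \sum_(a : vposet G) \sum_(1 <= i < (level a).+1) chi a i * shifted_nb_words G n i.
  pose m := (n + top_level G)%N.
  rewrite (big_nat_widen _ _ m.+1) ?ltnS ?leq_addr // big_mkcond /=.
  have level_m (a : vposet G) : ((level a).+1 <= m.+1)%N.
    by have := ltn_ord (level a); rewrite /m; clear; lia.
  under [in RHS]eq_bigr => a _ do rewrite (big_nat_widen _ _ m.+1) // big_mkcond /=.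
  rewrite exchange_big -sumrN; apply: eq_big_nat => i /andP[i0 _].
  rewrite ltnS -big_mkcond -mulr_suml mulrC /shifted_nb_words; case: ifP => _.
    by case: i i0 => // i _; rewrite /g mulNr.
  by rewrite mulr0 oppr0.
by rewrite subrr.
Qed.
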